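(* (Inversion count, independent uniform lifetimes.) Let $d\in\mathbb N$, $a_2,\dots,a_d>0$ and $W_n=[0,n]\times[0,a_2n]\times\dots\times[0,a_dn]$. Let $\mathcal P_n$ be a Poisson point process on $W_n\times[0,1]$ whose intensity measure is Lebesgue measure; a point $x\in\mathcal P_n$ has spatial location $\dot x\in W_n$ with first coordinate $x_1$ and mark (lifetime) $\ell_x\in[0,1]$. Let $$f(x,y,\mathcal P_n)=\mathbf 1\{(x_1-y_1)(x_1-y_1+\ell_x-\ell_y)<0,\ \ell_x,\ell_y\in(0,1)\}$$ and $\Sigma(\mathcal P_n)=\sum_{Z\in\mathcal P_n}\sum_{V\in\mathcal P_n}f(Z,V,\mathcal P_n)$. Then for every $\delta>0$ and all sufficiently large $n$, $$d_W\Big(\frac{\Sigma(\mathcal P_n)-\mathbb E[\Sigma(\mathcal P_n)]}{\sqrt{\mathbb V[\Sigma(\mathcal P_n)]}},\mathcal N(0,1)\Big)\le n^{-d/2+\delta}.$$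
   Context: $d_W(X,Y)=\sup_h|\mathbb E[h(X)]-\mathbb E[h(Y)]|$ over all $1$-Lipschitz $h:\mathbb R\to\mathbb R$; $\mathcal N(0,1)$ denotes a standard Normal variable; $\mathbb V$ is variance. *)

(* Defs.v *)
From HB Require Import structures.
From mathcomp Require Import all_boot all_order all_algebra finmap.
From mathcomp Require Import all_classical all_reals all_analysis.

Set Implicit Arguments.
Unset Strict Implicit.
Unset Printing Implicit Defensive.

Import Order.TTheory GRing.Theory Num.Theory.
Import numFieldNormedType.Exports.

Local Open Scope classical_set_scope.
Local Open Scope ring_scope.

Definition cons_pair (R : realType) n (p : R * n.-tuple R) : n.+1.-tuple R :=
  [tuple of p.1 :: p.2].

Definition cons_measure (R : realType) n (mu : set (n.-tuple R) -> \bar R) :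
    set (n.+1.-tuple R) -> \bar R :=
  pushforward (lebesgue_measure \x mu)%E (@cons_pair R n).

(* n-dimensional Lebesgue measure, obtained by iterating the product measure. *)
Fixpoint lebesgue_tuple (R : realType) (n : nat) : set (n.-tuple R) -> \bar R :=
  match n with
  | 0 => \d_[tuple]
  | m.+1 => cons_measure (@lebesgue_tuple R m)
  end.
Arguments lebesgue_tuple : clear implicits.

Section lebesgue_tuple_measure.
Context (R : realType).

Let measurable_cons_pair n : measurable_fun setT (@cons_pair R n).
Proof. exact: measurable_cons. Qed.

Let uncons n (t : n.+1.-tuple R) : R * n.-tuple R :=
  (thead t, [tuple of behead t]).

Let measurable_uncons n : measurable_fun setT (@uncons n).
Proof.
apply: measurable_fun_pair; first exact: measurable_tnth.
exact: measurable_behead.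
Qed.

Let cons_pairK n : cancel (@cons_pair R n) (@uncons n).
Proof. by move=> [x t]; congr (_, _); exact: val_inj. Qed.

Section cons_measure.
Variables (n : nat) (mu : {sigma_finite_measure set (n.-tuple R) -> \bar R}).

Let cons_measure0 : cons_measure mu set0 = 0%E.
Proof. by rewrite /cons_measure /pushforward preimage_set0 measure0. Qed.

Let cons_measure_ge0 A : (0 <= cons_measure mu A)%E.
Proof. exact: (@measure_ge0 _ _ _ (lebesgue_measure \x mu)%E). Qed.

Let cons_measure_semi_sigma_additive : semi_sigma_additive (cons_measure mu).
Proof.
have h := @measure_semi_sigma_additive _ _ _
  (measure_function_pushforward__canonical__measure_function_Measure
     (lebesgue_measure \x mu)%E (@measurable_cons_pair n)).
exact: h.
Qed.

HB.instance Definition _ := isMeasure.Build _ _ _ (cons_measure mu)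
  cons_measure0 cons_measure_ge0 cons_measure_semi_sigma_additive.

Let cons_measure_sigma_finite : sigma_finite setT (cons_measure mu).
Proof.
have /sigma_finiteP[F [FT ndF Foo]] := sigma_finiteT (@lebesgue_measure R).
have /sigma_finiteP[G [GT ndG Goo]] := sigma_finiteT mu.
exists (fun i => @uncons n @^-1` (F i `*` G i)).
  apply/esym/seteqP; split=> // t _; have [i _ Fi] : (\bigcup_i F i) (thead t).
    by rewrite -FT.
  have [j _ Gj] : (\bigcup_i G i) [tuple of behead t] by rewrite -GT.
  exists (maxn i j) => //; split.
    by move: Fi; exact/subsetPset/ndF/leq_maxl.
  by move: Gj; exact/subsetPset/ndG/leq_maxr.
move=> i; have [mF Fi] := Foo i; have [mG Gi] := Goo i; split.
  by rewrite -[X in measurable X]setTI; apply: measurable_uncons => //;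
    exact: measurableX.
rewrite /cons_measure /pushforward -comp_preimage (_ : _ \o _ = id).
  by rewrite [ltLHS]product_measure1E// lte_mul_pinfty// ge0_fin_numE.
by apply/funext => p; exact: cons_pairK.
Qed.

HB.instance Definition _ := Measure_isSigmaFinite.Build _ _ _ (cons_measure mu)
  cons_measure_sigma_finite.

End cons_measure.

Lemma lebesgue_tuple_sigma_finite_measure n :
  {mu : {sigma_finite_measure set (n.-tuple R) -> \bar R} |
    mu = lebesgue_tuple R n :> (set _ -> \bar R)}.
Proof.
elim: n => [|n [mu muE]]; first by exists \d_([tuple] : 0.-tuple R).
by exists (cons_measure mu); rewrite /= -muE.
Qed.

Section instance.
Variable n : nat.

Let lebesgue_tuple0 : lebesgue_tuple R n set0 = 0%E.
Proof.
by have [mu <-] := lebesgue_tuple_sigma_finite_measure n; exact: measure0.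
Qed.

Let lebesgue_tuple_ge0 A : (0 <= lebesgue_tuple R n A)%E.
Proof.
by have [mu <-] := lebesgue_tuple_sigma_finite_measure n; exact: measure_ge0.
Qed.

Let lebesgue_tuple_semi_sigma_additive :
  semi_sigma_additive (lebesgue_tuple R n).
Proof.
have [mu <-] := lebesgue_tuple_sigma_finite_measure n.
exact: measure_semi_sigma_additive.
Qed.

HB.instance Definition _ := isMeasure.Build _ _ _ (lebesgue_tuple R n)
  lebesgue_tuple0 lebesgue_tuple_ge0 lebesgue_tuple_semi_sigma_additive.

Let lebesgue_tuple_sigma_finite : sigma_finite setT (lebesgue_tuple R n).
Proof.
by have [mu <-] := lebesgue_tuple_sigma_finite_measure n; exact: sigma_finiteT.
Qed.

HB.instance Definition _ := Measure_isSigmaFinite.Build _ _ _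
  (lebesgue_tuple R n) lebesgue_tuple_sigma_finite.

End instance.
End lebesgue_tuple_measure.

Section poisson_process.
Context d (T : measurableType d) d' (Omega : measurableType d') (R : realType).
Implicit Types (P : probability Omega R) (X : Omega -> {fset T}).

Definition npoints X (A : set T) (w : Omega) : nat :=
  #|` [fset x in X w | x \in A]%fset|.

(* Taking some of the B i to be the full set gives the product rule for
   subfamilies. *)
Definition mutually_independent P k (N : 'I_k -> Omega -> nat) : Prop :=
  forall B : 'I_k -> set nat,
    P (\bigcap_i (N i @^-1` B i)) = (\prod_(i < k) P (N i @^-1` B i))%E.

(* X is a Poisson point process on D with intensity measure mu. This is meant
   for a diffuse mu that is finite on D: then the process has finitely many
   points, all of multiplicity one, and [fine (mu A)] is the true value of
   [mu A]. The second argument of [poisson_prob] is a dummy; for rate 0 (and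
   unlike [poisson_pmf]) it is the Dirac mass at 0. *)
Record poisson_process P (D : set T) (mu : set T -> \bar R) X : Prop := {
  pp_in : forall w x, x \in X w -> D x ;
  pp_measurable : forall A, measurable A -> A `<=` D ->
    measurable_fun [set: Omega] (npoints X A) ;
  pp_poisson : forall A, measurable A -> A `<=` D ->
    forall U : set nat,
      P (npoints X A @^-1` U) = poisson_prob (fine (mu A)) 0 U ;
  pp_independent : forall k (A : 'I_k -> set T),
    (forall i, measurable (A i)) -> (forall i, A i `<=` D) ->
    trivIset setT A -> mutually_independent P (fun i => npoints X (A i)) }.

End poisson_process.

(* Distance between the laws of X under P and of Y under Q; X and Y are meant
   to be integrable, so that no difference of infinite expectations occurs. *)
Definition wasserstein (R : realType) d1 (T1 : measurableType d1)
    d2 (T2 : measurableType d2) (P : probability T1 R) (X : T1 -> R)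
    (Q : probability T2 R) (Y : T2 -> R) : \bar R :=
  ereal_sup [set `|'E_P[h \o X] - 'E_Q[h \o Y]|%E |
             h in [set h : R -> R | 1.-lipschitz h]].

Definition standardize d (T : measurableType d) (R : realType)
    (P : probability T R) (X : T -> R) : T -> R :=
  fun w => (X w - fine 'E_P[X]) / Num.sqrt (fine 'V_P[X]).

(* A marked point is a pair (location, lifetime). Coordinates are numbered
   from 0, so that the first coordinate of a location t is t`_0. *)
Section inversions.
Context (R : realType) (d : nat).

(* [0, n] x [0, a_2 n] x ... x [0, a_d n], where a_j is [a j] for 2 <= j <= d;
   the other values of [a] are irrelevant. *)
Definition window (a : nat -> R) (n : nat) : set (d.-tuple R) :=
  [set t | forall i : 'I_d,
     0 <= tnth t i <= (if i == 0 :> nat then n%:R else a i.+1 * n%:R)].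

Definition inverted (x y : d.-tuple R * R) : bool :=
  let: (x1, lx) := (x.1`_0, x.2) in
  let: (y1, ly) := (y.1`_0, y.2) in
  [&& (x1 - y1) * (x1 - y1 + lx - ly) < 0, 0 < lx < 1 & 0 < ly < 1].

Definition inversions (X : {fset (d.-tuple R * R)}) : R :=
  \sum_(z <- X) \sum_(v <- X) (inverted z v)%:R.

End inversions.

(* Main.v *)
(* Whether two points are inverted depends only on their first coordinates and their
   lifetimes, and these pairs form a Poisson process on [0, n] x [0, 1] of intensity
   K = a_2 ... a_d n^(d-1). Cut this rectangle into squares of side 1/m and count the
   pairs of points lying in squares all of whose points are mutually inverted. This is
   a quadratic form in independent Poisson variables (the numbers of points in the
   squares), it converges pointwise to the inversion count as m grows, and it is
   dominated by the square of the total number of points, so that the error bounds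
   pass to the limit.

   For a quadratic form F in independent Poisson variables, Mecke's formula gives an
   explicit covariance identity
     Cov(F, G) = sum_j lam_j E[D_j^* F (G(N + e_j) - G(N))]
   in which D_j^* F is affine in N. Inserting it into Stein's equation
   phi'(x) - x phi(x) = h(x) - E[h(Z)] and expanding to second order leaves the
   fluctuations of another quadratic form, whose variance the same identity computes,
   and a remainder given by third moments. Both are O(1 / sqrt(n K)), because the
   variance of F is at least of order n K^3; as n K is of order n^d, the constant is
   absorbed by n^delta.

   Stein's equation is treated as the ODE psi' = x psi + r: a comparison argument bounds
   the solutions psi with psi(x) exp(-x^2/2) -> 0 by the growth of r. It applies both to
   the solution phi and to its difference quotients, which yields that phi' is Lipschitz. *)

Require Import Defs.
From mathcomp Require Import all_boot all_order all_algebra finmap.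
From mathcomp Require Import all_classical all_reals all_analysis.
From mathcomp Require Import measurable_realfun.
From mathcomp Require Import ring lra zify.

Set Implicit Arguments.
Unset Strict Implicit.
Unset Printing Implicit Defensive.

Import Order.TTheory GRing.Theory Num.Theory.
Import numFieldNormedType.Exports.

Local Open Scope classical_set_scope.
Local Open Scope ring_scope.

(** * Stein's equation with Lipschitz right-hand side *)

Section stein_ode.
Context {R : realType}.
Implicit Types (f g psi r : R -> R) (x : R).

(** Integrating factor of Stein's equation: if psi' = x psi + r, then (psi gamma)' = r gamma. *)
Definition gamma x : R := expR (- (x ^+ 2 / 2)).

Lemma gamma_gt0 x : 0 < gamma x.
Proof. exact: expR_gt0. Qed.

Lemma is_derive_mul f g x a b : is_derive x 1 f a -> is_derive x 1 g b ->
  is_derive x 1 (fun y => f y * g y) (a * g x + f x * b).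
Proof.
by move=> df dg; apply: is_derive_eq; rewrite /GRing.scale/=; ring.
Qed.

Lemma is_derive_sub f g x a b : is_derive x 1 f a -> is_derive x 1 g b ->
  is_derive x 1 (fun y => f y - g y) (a - b).
Proof. by move=> df dg; apply: is_derive_eq. Qed.

Lemma is_derive_addc c f x a : is_derive x 1 f a ->
  is_derive x 1 (fun y => c + f y) a.
Proof.
move=> df; have := is_deriveD (is_derive_cst c x 1) df.
by rewrite add0r.
Qed.

Lemma is_derive_shift f s x a : is_derive (x + s) 1 f a ->
  is_derive x 1 (fun y => f (y + s)) a.
Proof.
move=> df; have ds : is_derive x 1 (fun y => y + s) 1.
  by apply: is_derive_eq; rewrite addr0.
by have := @is_derive1_comp R f (fun y => y + s) x a 1 df ds; rewrite mulr1.
Qed.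

Lemma is_derive_reflect f x a : is_derive (- x) 1 f a ->
  is_derive x 1 (fun y => f (- y)) (- a).
Proof.
move=> df; have ds : is_derive x 1 (fun y => - y) (- 1) by apply: is_derive_eq.
by have := @is_derive1_comp R f (fun y => - y) x a (- 1) df ds; rewrite mulrN1.
Qed.

Lemma is_derive_gamma x : is_derive x 1 gamma (- x * gamma x).
Proof.
have d1 : is_derive x 1 (fun y => - 2^-1 * (y * y)) (- x).
  have := is_derive_mul (is_derive_cst (- 2^-1 : R) x 1)
    (is_derive_mul (is_derive_id x 1) (is_derive_id x 1)).
  by move=> h; apply: is_derive_eq; rewrite /cst; field.
have := is_derive1_comp (is_derive_expR _) d1.
rewrite (_ : expR \o _ = gamma); last first.
  by apply/funext => y; rewrite /gamma/=; congr expR; rewrite expr2; field.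
by rewrite mulrC /gamma expr2 (_ : - 2^-1 * (x * x) = - (x * x / 2))//; field.
Qed.

(* [v x = A + 2 B / (1 + x)] satisfies [v' <= x v - (A x + B)], so that
   [(v - psi) gamma] is nonincreasing; it cannot be negative since it tends
   to a nonnegative limit. *)
Lemma stein_comparison psi r (A B : R) : 0 <= A -> 0 <= B ->
  (forall x, is_derive x 1 psi (x * psi x + r x)) ->
  (forall x, 0 <= x -> `|r x| <= A * x + B) ->
  (forall x0 e, 0 < e -> exists2 x, x0 <= x & `|psi x| * gamma x <= e) ->
  forall x, 0 <= x -> psi x <= A + 2 * B / (1 + x).
Proof.
move=> A0 B0 dpsi rAB psi0 x x_ge0.
pose u y := (A + 2 * B * (1 + y)^-1 - psi y) * gamma y.
pose u' y := (- (2 * B * (1 + y) ^- 2) - r y - A * y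
              - 2 * B * y * (1 + y)^-1) * gamma y.
have du (y : R) : 0 <= y -> is_derive y 1 u (u' y).
  move=> y0; have y1 : 1 + y != 0 by rewrite gt_eqF// ltr_pwDl.
  have dV : is_derive y 1 (fun z => 2 * B * (1 + z)^-1) (- (2 * B * (1 + y) ^- 2)).
    have d1 : is_derive y 1 (fun z : R => 1 + z) 1.
      exact: is_derive_addc.
    have d2 : is_derive y 1 (fun z : R => (1 + z)^-1) (- (1 + y) ^- 2).
      split; first exact: derivableV.
      by rewrite deriveV// derive_val /GRing.scale/= mulr1.
    have := is_derive_mul (is_derive_cst (2 * B) y 1) d2.
    by move=> h; apply: is_derive_eq; rewrite /cst; ring.
  have dA : is_derive y 1 (fun z => A + 2 * B * (1 + z)^-1) (- (2 * B * (1 + y) ^- 2)).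
    exact: is_derive_addc.
  have := is_derive_mul (is_derive_sub dA (dpsi y)) (is_derive_gamma y).
  move=> h; apply: is_derive_eq.
  by rewrite /u'; field.
have u'_le0 (y : R) : 0 <= y -> u' y <= 0.
  move=> y0; rewrite /u' pmulr_lle0 ?gamma_gt0//.
  have := rAB _ y0; rewrite ler_norml => /andP[ry _].
  have y1 : 0 < 1 + y by rewrite ltr_pwDl.
  (* The factor 2 in front of B leaves the nonnegative remainder B (1 + y^2) / (1 + y)^2. *)
  have : B <= 2 * B * (1 + y) ^- 2 + 2 * B * y * (1 + y)^-1.
    rewrite -subr_ge0 (_ : _ - _ = B * (1 + y ^+ 2) * (1 + y) ^- 2); last first.
      by field; rewrite gt_eqF.
    by rewrite !mulr_ge0 ?invr_ge0 ?sqr_ge0// addr_ge0 ?sqr_ge0.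
  lra.
have u_noninc (y : R) : x <= y -> u y <= u x.
  move=> xy; have [| | c /[!in_itv]/= /andP[xc cy]] :=
      @MVT_segment _ u u' x y xy.
  - move=> z /[!in_itv]/= /andP[xz zy]; apply: du.
    by rewrite ltW// (le_lt_trans x_ge0).
  - apply: continuous_in_subspaceT => z /[!inE]/= /[!in_itv]/= /andP[xz zy].
    apply: differentiable_continuous; apply/derivable1_diffP.
    by have [] := du z (le_trans x_ge0 xz).
  move=> /eqP; rewrite subr_eq => /eqP ->; rewrite gerDr.
  by rewrite mulr_le0_ge0 ?subr_ge0// u'_le0// (le_trans x_ge0).
rewrite leNgt; apply/negP => vpsi.
have ux : u x < 0.
  by rewrite /u pmulr_llt0 ?gamma_gt0// subr_lt0.
(* At such a y, u y >= - |psi y| gamma y >= u x / 2 > u x, against the monotonicity of u. *)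
have [|y xy psiy] := psi0 x (- u x / 2); first by rewrite divr_gt0// oppr_gt0.
have := u_noninc y xy; apply/negP; rewrite -ltNge.
rewrite (@lt_le_trans _ _ (u x / 2))//; first by lra.
rewrite (_ : u y = (A + 2 * B / (1 + y)) * gamma y - psi y * gamma y); last by rewrite -mulrBl.
have y1 : 0 <= y by rewrite (le_trans x_ge0).
have v0 : 0 <= (A + 2 * B / (1 + y)) * gamma y.
  by rewrite mulr_ge0 ?expR_ge0// addr_ge0// divr_ge0 ?mulr_ge0// addr_ge0.
have : psi y * gamma y <= `|psi y| * gamma y.
  by rewrite ler_wpM2r ?expR_ge0// ler_norm.
lra.
Qed.

Lemma gammaN x : gamma (- x) = gamma x.
Proof. by rewrite /gamma sqrrN. Qed.

(** The equation keeps its form under psi -> - psi and under psi -> - psi (- x), so the one-sided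
    comparison on the positive half-line gives all four bounds. The decay of |psi| gamma is required
    only at arbitrarily distant points, because the solution built below is controlled along the
    integers. *)
Lemma stein_bound psi r (A B : R) : 0 <= A -> 0 <= B ->
  (forall x, is_derive x 1 psi (x * psi x + r x)) ->
  (forall x, `|r x| <= A * `|x| + B) ->
  (forall x0 e, 0 < e -> exists2 x, x0 <= x & `|psi x| * gamma x <= e) ->
  (forall x0 e, 0 < e -> exists2 x, x <= x0 & `|psi x| * gamma x <= e) ->
  forall x, `|psi x| <= A + 2 * B / (1 + `|x|).
Proof.
move=> A0 B0.
have nonneg (psi1 r1 : R -> R) :
  (forall x, is_derive x 1 psi1 (x * psi1 x + r1 x)) ->
  (forall x, `|r1 x| <= A * `|x| + B) ->
  (forall x0 e, 0 < e -> exists2 x, x0 <= x & `|psi1 x| * gamma x <= e) ->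
  forall x, 0 <= x -> `|psi1 x| <= A + 2 * B / (1 + `|x|).
  move=> d1 r1AB lim1 x x0; rewrite (ger0_norm x0) ler_norml lerNl.
  apply/andP; split; last first.
    apply: stein_comparison d1 _ lim1 _ x0 => //.
    by move=> y y0; have := r1AB y; rewrite (ger0_norm y0).
  apply: (@stein_comparison (\- psi1) (\- r1)) => //.
  - move=> y; have dy := d1 y; apply: is_derive_eq => /=; ring.
  - by move=> y y0; have := r1AB y; rewrite (ger0_norm y0) /= normrN.
  - by move=> x1 e e0; have [y ? ?] := lim1 x1 e e0; exists y => //=; rewrite normrN.
move=> dpsi rAB limy limNy x; have [x0|x0] := leP 0 x; first exact: nonneg rAB _ _ x0.
rewrite -normrN -(normrN x) -{1}(opprK x).
apply: (@nonneg (fun y => - psi (- y)) (fun y => r (- y))).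
- move=> y; have := is_derive_reflect (dpsi (- y)).
  move=> /is_deriveN h; apply: is_derive_eq; ring.
- by move=> y; rewrite -(normrN y).
- move=> x1 e e0; have [y yx ye] := limNy (- x1) e e0.
  exists (- y); first by rewrite lerNr.
  by rewrite opprK normrN gammaN.
- by rewrite oppr_ge0 ltW.
Qed.

End stein_ode.

(** * Integration against the normal law *)

Section normal_expectation.
Context {R : realType}.
Local Notation mu := (@lebesgue_measure R).
Implicit Types (f g h : R -> R) (m s : R).

(** The Radon-Nikodym derivative of the normal law has the same integral as the explicit density
    over every measurable set, so the two agree almost everywhere. *)
Lemma ge0_integral_normal_prob f m s : measurable_fun [set: R] f ->
  (forall x, 0 <= f x) ->
  (\int[normal_prob m s]_x (f x)%:E = \int[mu]_x (f x * normal_pdf m s x)%:E)%E.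
Proof.
move=> mf f0; have Qmu := @normal_prob_dominates R m s.
have mfE : measurable_fun [set: R] (fun x => (f x)%:E) by exact/measurable_EFinP.
rewrite -(@Radon_Nikodym_SigmaFinite.change_of_variables _ _ _ (normal_prob m s)
  mu Qmu (EFin \o f) setT)//.
under [RHS]eq_integral do rewrite EFinM.
have mpdf : measurable_fun [set: R] (fun x => (normal_pdf m s x)%:E).
  by apply/measurable_EFinP; exact: measurable_normal_pdf.
apply: ae_eq_integral => //.
- apply: emeasurable_funM => //.
  exact: (measurable_int _ (Radon_Nikodym_SigmaFinite.f_integrable Qmu)).
- exact: emeasurable_funM.
- apply: ae_eqe_mul2l; apply: integral_ae_eq => //=.
  + exact: Radon_Nikodym_SigmaFinite.f_integrable.
  + by move=> A _ mA; rewrite -Radon_Nikodym_SigmaFinite.f_integral.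
Qed.

Lemma integral_normal_prob f m s : measurable_fun [set: R] f ->
  (\int[normal_prob m s]_x (f x)%:E = \int[mu]_x (f x * normal_pdf m s x)%:E)%E.
Proof.
move=> mf; rewrite integralE [RHS]integralE; congr (_ - _)%E.
- transitivity (\int[normal_prob m s]_x (Num.max (f x) 0)%:E)%E.
    by apply: eq_integral => x _; rewrite funeposE EFin_max.
  rewrite ge0_integral_normal_prob//; first last.
  + by move=> x; rewrite le_max lexx orbT.
  + exact: measurable_maxr.
  apply: eq_integral => x _; rewrite funeposE -EFin_max.
  by rewrite maxr_pMl ?normal_pdf_ge0// mul0r.
- transitivity (\int[normal_prob m s]_x (Num.max (- f x) 0)%:E)%E.
    by apply: eq_integral => x _; rewrite funenegE EFin_max.
  rewrite ge0_integral_normal_prob//; first last.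
  + by move=> x; rewrite le_max lexx orbT.
  + by apply: measurable_maxr => //; exact: measurableT_comp.
  apply: eq_integral => x _; rewrite funenegE -EFinN -EFin_max.
  by rewrite -mulNr maxr_pMl ?normal_pdf_ge0// mul0r.
Qed.

Lemma normal_pdf01E x : normal_pdf 0 1 x = normal_peak 1 * gamma x :> R.
Proof.
rewrite /normal_pdf (negbTE (oner_neq0 R)) /normal_fun /gamma.
by rewrite subr0 expr1n mulNr.
Qed.

(** Since |x| <= e^(|x| - 1), it suffices that |x| - 1 <= 3 x^2 / 8. The wider Gaussian e^(-x^2/8)
    absorbs the linear growth, which yields a first absolute moment without computing it. *)
Lemma norm_gamma_le (x : R) : `|x| * gamma x <= normal_fun 0 2 x.
Proof.
have := expR_ge1Dx (`|x| - 1); rewrite addrC subrK => xe.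
rewrite (le_trans (ler_wpM2r (expR_ge0 _) xe))//.
rewrite /normal_fun /gamma -expRD ler_expR subr0 -(real_normK (num_real x)).
have := sqr_ge0 (3 * `|x| - 4); nra.
Qed.

Lemma integrable_norm_normal_pdf :
  mu.-integrable [set: R] (fun x => (`|x| * normal_pdf 0 1 x)%:E).
Proof.
have peak2 : (0 : R) < normal_peak 2 by rewrite normal_peak_gt0// pnatr_eq0.
pose C : R := normal_peak 1 / normal_peak 2.
have C0 : 0 <= C by rewrite divr_ge0 ?normal_peak_ge0.
apply: (@le_integrable _ _ _ mu _ _ _ (fun x => C%:E * (normal_pdf 0 2 x)%:E)%E) => //.
- apply/measurable_EFinP; apply: measurable_funM; first exact: normr_measurable.
  exact: measurable_normal_pdf.
- move=> x _; rewrite -EFinM !abse_EFin lee_fin.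
  rewrite [leLHS]ger0_norm ?[leRHS]ger0_norm ?mulr_ge0 ?normal_pdf_ge0 ?invr_ge0 ?normal_peak_ge0//.
  rewrite normal_pdf01E.
  rewrite /normal_pdf pnatr_eq0/= /C [leRHS]mulrA.
  rewrite divfK ?gt_eqF// mulrCA ler_wpM2l ?normal_peak_ge0//.
  exact: norm_gamma_le.
- by apply: integrableZl => //; exact: integrable_normal_pdf.
Qed.

Lemma cvg_integral_Nyy g : mu.-integrable [set: R] (EFin \o g) ->
  (\int[mu]_(t in `]-oo, n%:R]) g t)%R @[n --> \oo] --> (\int[mu]_t g t)%R.
Proof.
move=> ig; apply: fine_cvg; rewrite fineK; last exact: integrable_fin_num.
rewrite (_ : (fun n => _) = fun n => \int[mu]_t ((g \_ `]-oo, n%:R]) t)%:E)%E; last first.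
  apply/funext => n; rewrite integral_mkcond; apply: eq_integral => x _.
  by rewrite restrict_EFin.
have mg : measurable_fun [set: R] g.
  by apply/measurable_EFinP; exact: (measurable_int _ ig).
apply: (@dominated_cvg _ _ _ mu setT _ _ (EFin \o g) (fun x => `|(g x)%:E|%E)) => //.
- move=> n; apply/measurable_EFinP; apply/(measurable_restrictT _ _).1 => //.
  exact: measurable_funTS.
- move=> x _; apply: cvg_near_cst; near=> n.
  rewrite patchE mem_set//= in_itv/=.
  near: n; exact: nbhs_infty_ger.
- exact: integrable_abse.
- move=> n x _; rewrite patchE; case: ifPn => // _.
  by rewrite abse0 abse_ge0.
Unshelve. all: by end_near. Qed.

Lemma cvg_integral_NyNy g : mu.-integrable [set: R] (EFin \o g) ->
  (\int[mu]_(t in `]-oo, - n%:R]) g t)%R @[n --> \oo] --> (0 : R).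
Proof.
move=> ig; apply: fine_cvg.
rewrite (_ : (fun n => _) = fun n => \int[mu]_t ((g \_ `]-oo, - n%:R]) t)%:E)%E; last first.
  apply/funext => n; rewrite integral_mkcond; apply: eq_integral => x _.
  by rewrite restrict_EFin.
have mg : measurable_fun [set: R] g.
  by apply/measurable_EFinP; exact: (measurable_int _ ig).
rewrite (_ : 0%:E = \int[mu]_t cst 0%E t)%E; last by rewrite integral0.
apply: (@dominated_cvg _ _ _ mu setT _ _ (cst 0%E) (fun x => `|(g x)%:E|%E)) => //.
- move=> n; apply/measurable_EFinP; apply/(measurable_restrictT _ _).1 => //.
  exact: measurable_funTS.
- move=> x _; apply: cvg_near_cst; near=> n.
  rewrite patchE memNset//= in_itv/=; apply/negP; rewrite -ltNge ltrNl.
  near: n; exact: nbhs_infty_gtr.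
- exact: integrable_abse.
- move=> n x _; rewrite patchE; case: ifPn => // _.
  by rewrite abse0 abse_ge0.
Unshelve. all: by end_near. Qed.

End normal_expectation.

(** * Normal means of Lipschitz functions *)

Section stein_solution.
Context {R : realType}.
Local Notation mu := (@lebesgue_measure R).
Local Notation p := (@normal_pdf R 0 1).
Implicit Types (h : R -> R) (x : R).

Lemma klipschitz1P h : 1.-lipschitz h <-> forall x y, `|h x - h y| <= `|x - y|.
Proof.
split=> [lip x y|lip [x y] _ /=]; last by rewrite mul1r; exact: lip.
by have := lip (x, y) (conj I I); rewrite /= mul1r.
Qed.

Lemma klipschitz1_continuous h : 1.-lipschitz h -> continuous h.
Proof.
move=> /klipschitz1P lip x; apply/cvgrPdist_le => e e0.
apply/nbhs_ballP; exists e => //= y; rewrite /ball/= => /ltW.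
exact: le_trans (lip x y).
Qed.

Lemma klipschitz1_measurable h : 1.-lipschitz h -> measurable_fun [set: R] h.
Proof. by move=> /klipschitz1_continuous; exact: continuous_measurable_fun. Qed.

Lemma integrable_lipschitz_normal_pdf h : 1.-lipschitz h ->
  mu.-integrable [set: R] (fun x => (h x * p x)%:E).
Proof.
move=> lip; apply: (@le_integrable _ _ _ mu _ _ _
  (fun x => (`|h 0|%:E * (p x)%:E) + (`|x| * p x)%:E)%E) => //.
- apply/measurable_EFinP; apply: measurable_funM.
    exact: klipschitz1_measurable.
  exact: measurable_normal_pdf.
- move=> x _; rewrite -EFinM -EFinD !abse_EFin lee_fin -mulrDl !normrM.
  rewrite ler_wpM2r// [leRHS]ger0_norm ?addr_ge0//.
  have /klipschitz1P/(_ x 0) := lip; rewrite subr0 => hx.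
  by rewrite -(subrK (h 0) (h x)) (le_trans (ler_normD _ _))// addrC lerD2l.
- apply: integrableD => //; last exact: integrable_norm_normal_pdf.
  by apply: integrableZl => //; exact: integrable_normal_pdf.
Qed.

Definition normal_mean h : R := (\int[mu]_x (h x * p x))%R.

Lemma expectation_normal_prob h : 1.-lipschitz h ->
  ('E_(normal_prob 0 1)[h \o idfun] = (normal_mean h)%:E)%E.
Proof.
move=> lip; rewrite unlock -[LHS]/(\int[normal_prob 0 1]_w (h w)%:E)%E.
rewrite integral_normal_prob; last exact: klipschitz1_measurable.
rewrite fineK//; apply: integrable_fin_num => //.
exact: integrable_lipschitz_normal_pdf.
Qed.

Lemma Rintegral_normal_pdf : (\int[mu]_x p x)%R = 1.
Proof. by rewrite /Rintegral integral_normal_pdf. Qed.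

(** The left-hand side is the absolute mean of h x - h Z with Z standard normal, and |x - Z| <= |x|
    + |Z|. This is the linear growth that [stein_bound] takes as input, with A = 1. *)
Lemma normal_mean_dist h x : 1.-lipschitz h ->
  `|h x - normal_mean h| <= `|x| + normal_mean (fun t => `|t|).
Proof.
move=> lip; have ip := integrable_normal_pdf (0 : R) 1.
have ih := integrable_lipschitz_normal_pdf lip.
have iZ (c : R) : mu.-integrable [set: R] (EFin \o (fun t => c * p t)).
  exact: (integrableZl measurableT c ip).
have inorm : mu.-integrable [set: R] (EFin \o (fun t => `|t| * p t)).
  exact: integrable_norm_normal_pdf.
have -> : h x - normal_mean h = (\int[mu]_t ((h x - h t) * p t))%R.
  under eq_Rintegral do rewrite mulrBl.
  rewrite RintegralB//.
  by rewrite RintegralZl// Rintegral_normal_pdf mulr1.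
have ihx : mu.-integrable [set: R] (fun t => ((h x - h t) * p t)%:E).
  rewrite (_ : (fun t => _) = EFin \o (fun t => h x * p t - h t * p t)); last first.
    by apply/funext => t /=; rewrite mulrBl.
  exact: (integrableB measurableT (iZ (h x)) ih).
rewrite (le_trans (le_normr_Rintegral _ _))//.
have -> : `|x| + normal_mean (fun t => `|t|) = (\int[mu]_t (`|x| * p t + `|t| * p t))%R.
  by rewrite RintegralD// RintegralZl// Rintegral_normal_pdf mulr1.
apply: le_Rintegral => //.
- exact: (integrable_abse ihx).
- exact: (integrableD measurableT (iZ `|x|) inorm).
- move=> t _; rewrite normrM (ger0_norm (normal_pdf_ge0 _ _ _)) -mulrDl.
  rewrite ler_wpM2r ?normal_pdf_ge0//.
  have /klipschitz1P/(_ x t) := lip; move/le_trans; apply; exact: ler_normB.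
Qed.

End stein_solution.

(** * The solution of Stein's equation and its regularity *)

Section stein_equation.
Context {R : realType}.
Local Notation mu := (@lebesgue_measure R).
Local Notation p := (@normal_pdf R 0 1).
Implicit Types (h f phi : R -> R) (x : R).

Let peak_gt0 : (0 : R) < normal_peak 1.
Proof. by rewrite normal_peak_gt0// oner_eq0. Qed.

Lemma cvg0_gamma x0 (C e : R) : 0 < e -> 0 <= C ->
  exists2 x, x0 <= x & C * gamma x <= e.
Proof.
move=> e0 C0; exists (`|x0| + 2 * C / e + 1).
  rewrite -addrA (le_trans (ler_norm _))// lerDl addr_ge0//.
  by rewrite divr_ge0// ?mulr_ge0// ltW.
set x := _ + 1.
have x1 : 1 <= x by rewrite lerDr addr_ge0// divr_ge0 ?mulr_ge0// ltW.
have xC : 2 * C / e <= x.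
  by rewrite /x -addrA addrCA lerDl addr_ge0.
have : x / 2 <= expR (x ^+ 2 / 2).
  by have := expR_ge1Dx (x ^+ 2 / 2); nra.
rewrite /gamma expRN => xe; rewrite ler_pdivrMr ?expR_gt0//.
rewrite mulrC -ler_pdivrMr//; apply: le_trans xe.
by rewrite ler_pdivlMr// mulrC mulrA.
Qed.

Lemma lim0_gamma phi (C : R) : (forall x, `|phi x| <= C) ->
  (forall x0 e, 0 < e -> exists2 x, x0 <= x & `|phi x| * gamma x <= e) /\
  (forall x0 e, 0 < e -> exists2 x, x <= x0 & `|phi x| * gamma x <= e).
Proof.
move=> phiC; have C0 : 0 <= C by exact: le_trans (phiC 0).
split=> x0 e e0.
  have [x xx0 xe] := cvg0_gamma x0 e0 C0; exists x => //.
  by rewrite (le_trans _ xe)// ler_wpM2r ?expR_ge0.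
have [x xx0 xe] := cvg0_gamma (- x0) e0 C0.
exists (- x); first by rewrite lerNl.
by rewrite gammaN (le_trans _ xe)// ler_wpM2r ?expR_ge0.
Qed.

(** Variation of constants: phi is the integral Y of (h - c) p over the half-line up to x, divided
    by the density p. Then phi gamma is a constant multiple of Y, which vanishes at minus infinity
    by integrability and at plus infinity because h - c has normal mean zero. *)
Lemma stein_antiderivative h : 1.-lipschitz h ->
  exists phi : R -> R,
  [/\ forall x, is_derive x 1 phi (x * phi x + (h x - normal_mean h)),
      forall x0 e, 0 < e -> exists2 x, x0 <= x & `|phi x| * gamma x <= e &
      forall x0 e, 0 < e -> exists2 x, x <= x0 & `|phi x| * gamma x <= e].
Proof.
move=> lip; set c := normal_mean h.
pose g t := (h t - c) * p t.
have ip : mu.-integrable [set: R] (EFin \o p) by exact: integrable_normal_pdf.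
have ih : mu.-integrable [set: R] (EFin \o (fun t => h t * p t)).
  exact: integrable_lipschitz_normal_pdf.
have ig : mu.-integrable [set: R] (EFin \o g).
  rewrite (_ : g = (fun t => h t * p t - c * p t)); last first.
    by apply/funext => t /=; rewrite -mulrBl.
  exact: (integrableB measurableT ih (integrableZl measurableT c ip)).
have g0 : (\int[mu]_t g t)%R = 0.
  under eq_Rintegral do rewrite /g mulrBl.
  rewrite RintegralB//; last exact: (integrableZl measurableT c ip).
  by rewrite RintegralZl// Rintegral_normal_pdf mulr1 subrr.
pose Y x := (\int[mu]_(t in `]-oo, x]) g t)%R.
have gE t : g t = (h t - c) * (normal_peak 1 * gamma t).
  by rewrite /g normal_pdf01E.
have cg : continuous g.
  move=> x; apply: cvgM.
    by apply: cvgB; [exact: klipschitz1_continuous|exact: cvg_cst].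
  exact: continuous_normal_pdf (oner_neq0 _) x.
have dY x : is_derive x 1 Y (g x).
  have [||||d1 d2] := @continuous_FTC1 R g -oo%O x (x + 1).
  - by rewrite ltrDl.
  - exact: integrableS ig.
  - by rewrite ltNyr.
  - exact: cg.
  by apply: DeriveDef; [exact: d1|rewrite -derive1E; exact: d2].
pose E x := (normal_peak 1 * gamma x)^-1.
have dE x : is_derive x 1 E (x * E x).
  have n0 : normal_peak 1 * gamma x != 0.
    by rewrite mulf_neq0// gt_eqF// gamma_gt0.
  have d1 := is_derive_mul (is_derive_cst (normal_peak 1 : R) x 1) (is_derive_gamma x).
  have d2 : is_derive x 1 E (- (normal_peak 1 * gamma x) ^- 2 * (- x * (normal_peak 1 * gamma x))).
    split; first exact: derivableV.
    rewrite deriveV// derive_val /GRing.scale/= /cst; ring.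
  apply: is_derive_eq; rewrite /E; field.
  by move: n0; rewrite mulf_eq0 negb_or andbC.
have phigE x : Y x * E x * gamma x = Y x / normal_peak 1.
  rewrite /E invfM; field; rewrite !gt_eqF ?gamma_gt0//.
have lim (a : nat -> R) : (Y (a n) @[n --> \oo] --> 0) -> forall e, 0 < e ->
    \forall n \near \oo, `|Y (a n) * E (a n)| * gamma (a n) <= e.
  move=> Ya e e0; move/cvgrPdist_le : Ya => /(_ _ (mulr_gt0 e0 peak_gt0)).
  apply: filterS => n; rewrite sub0r normrN => Yn.
  rewrite -(ger0_norm (ltW (gamma_gt0 (a n)))) -normrM phigE normrM.
  by rewrite normfV (gtr0_norm peak_gt0) ler_pdivrMr.
exists (fun x => Y x * E x); split.
- move=> x; have := is_derive_mul (dY x) (dE x).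
  have -> : g x * E x = h x - c.
    by rewrite gE /E mulfK// mulf_neq0// gt_eqF ?gamma_gt0.
  by rewrite addrC mulrCA.
- move=> x0 e e0.
  have /lim/(_ e e0) h1 : Y n%:R @[n --> \oo] --> 0.
    by have := cvg_integral_Nyy ig; rewrite g0.
  near \oo => n; exists n%:R; last by near: n.
  by near: n; exact: nbhs_infty_ger.
- move=> x0 e e0.
  have /lim/(_ e e0) h1 : Y (- n%:R) @[n --> \oo] --> 0.
    exact: cvg_integral_NyNy ig.
  near \oo => n; exists (- n%:R); last by near: n.
  by rewrite lerNl; near: n; exact: nbhs_infty_ger.
Unshelve. all: by end_near. Qed.

(* The difference quotients of a solution solve Stein's equation for the
   difference quotients of [x phi + h], which are bounded; hence the bound on
   the second order behaviour of [phi] although [h] need not be differentiable. *)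
Lemma stein_equation : exists2 K : R, 0 < K &
  forall h, 1.-lipschitz h -> exists phi dphi : R -> R,
  [/\ forall x, is_derive x 1 phi (dphi x),
      forall x, dphi x - x * phi x = h x - normal_mean h,
      forall x, `|phi x| <= K, forall x, `|dphi x| <= K &
      forall x y, `|dphi x - dphi y| <= K * `|x - y|].
Proof.
pose M : R := normal_mean (fun t => `|t|).
have M0 : 0 <= M.
  by apply: Rintegral_ge0 => x _; rewrite mulr_ge0 ?normal_pdf_ge0.
(* The inhomogeneity [r] of the equation for difference quotients is a value of phi, at most 1 + 2
   M, plus a difference quotient of h, at most 1. *)
pose B := 1 + 2 * M + 1.
have B0 : 0 <= B by rewrite !addr_ge0// mulr_ge0.
exists (5 * B) => [|h lip]; first by rewrite mulr_gt0// ltr_wpDl// addr_ge0// mulr_ge0.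
have [phi [dphi limy limNy]] := stein_antiderivative lip.
set c := normal_mean h in dphi *.
pose d x := x * phi x + (h x - c).
have /klipschitz1P hlip := lip.
have inv1_le (z : R) : (1 + `|z|)^-1 <= 1 by rewrite invf_le1 ?lerDl// ltr_pwDl.
have phiB x : `|phi x| <= 1 + 2 * M.
  have := stein_bound ler01 M0 dphi _ limy limNy x.
  move=> /(_ _)/le_trans; apply.
    by move=> y; rewrite mul1r; exact: normal_mean_dist.
  by rewrite lerD2l ler_piMr// mulr_ge0.
have quot (s x : R) : 0 < s ->
    `|(phi (x + s) - phi x) / s| <= 2 * B /\ `|(d (x + s) - d x) / s| <= 3 * B.
  move=> s0; pose q y := (phi (y + s) - phi y) * s^-1.
  pose r y := phi (y + s) + (h (y + s) - h y) * s^-1.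
  have sn0 : s != 0 by rewrite gt_eqF.
  have dq (y : R) : is_derive y 1 q (y * q y + r y).
    have := is_derive_mul (is_derive_sub (is_derive_shift (dphi (y + s))) (dphi y))
      (is_derive_cst s^-1 y 1).
    move=> h0; apply: is_derive_eq; rewrite /q /r /cst; field.
    exact: sn0.
  have rB (y : R) : `|r y| <= 0 * `|y| + B.
    rewrite mul0r add0r (le_trans (ler_normD _ _))// lerD//.
    rewrite normrM normfV (gtr0_norm s0) ler_pdivrMr// mul1r.
    by rewrite (le_trans (hlip _ _))// [y + s]addrC addrK gtr0_norm.
  have qC (y : R) : `|q y| <= (1 + 2 * M + (1 + 2 * M)) / s.
    rewrite normrM normfV (gtr0_norm s0) ler_wpM2r ?invr_ge0 ?(ltW s0)//.
    by rewrite (le_trans (ler_normB _ _))// lerD.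
  have [qy qNy] := lim0_gamma qC.
  have qB := stein_bound (lexx 0) B0 dq rB qy qNy x.
  rewrite add0r in qB.
  have x1 : 0 < 1 + `|x| by rewrite ltr_pwDl.
  split.
    by rewrite (le_trans qB)// ler_piMr// mulr_ge0.
  (* The decay 2 B / (1 + |x|) of the bound on q compensates the factor x. *)
  have -> : (d (x + s) - d x) / s = x * q x + r x.
    by rewrite /d /q /r; field.
  rewrite (le_trans (ler_normD _ _))//.
  have -> : 3 * B = 2 * B + B by ring.
  rewrite lerD//; last by have := rB x; rewrite mul0r add0r.
  rewrite normrM (le_trans (ler_wpM2l (normr_ge0 x) qB))// mulrCA.
  by rewrite ler_piMr ?mulr_ge0// ler_pdivrMr// mul1r lerDr.
have dlip (x y : R) : `|d x - d y| <= 3 * B * `|x - y|.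
  wlog xy : x y / x < y.
    move=> wl; have [/wl//|/wl|->] := ltgtP x y; last by rewrite !subrr !normr0 mulr0.
    by rewrite distrC (distrC x).
  have yx0 : 0 < y - x by rewrite subr_gt0.
  have [_] := quot _ x yx0.
  rewrite [x + _]addrC subrK normrM normfV (gtr0_norm yx0) ler_pdivrMr//.
  by rewrite distrC (distrC x) (gtr0_norm yx0).
exists phi, d; split => //.
- by move=> x; rewrite /d addrC addKr.
- by move=> x; rewrite (le_trans (phiB x))//; rewrite /B; lra.
(* Some value of d on [x, x + 1] is a difference quotient of phi, of size at most 2 B, and d varies
   by at most 3 B on that interval; hence 5 B. *)
- move=> x; have [| | z /[!in_itv]/= /andP[xz zx]] := @MVT_segment _ phi d x (x + 1).
  + by rewrite lerDl.
  + apply: continuous_in_subspaceT => y _.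
    apply: differentiable_continuous; apply/derivable1_diffP.
    by have [] := dphi y.
  rewrite (_ : x + 1 - x = 1); last by ring.
  rewrite mulr1 => dz; have := (quot 1 x ltr01).1.
  rewrite divr1 dz => dB.
  rewrite -(subrK (d z) (d x)) (le_trans (ler_normD _ _))//.
  have -> : 5 * B = 3 * B * 1 + 2 * B by ring.
  rewrite lerD// (le_trans (dlip _ _))// ler_wpM2l ?mulr_ge0//.
  by rewrite ler_norml; apply/andP; split; lra.
- by move=> x y; rewrite (le_trans (dlip _ _))// ler_wpM2r// ler_wpM2r// ler_nat.
Qed.

(** As dphi is merely Lipschitz, the mean value theorem replaces Taylor's formula, at the price of K
    instead of K / 2. *)
Lemma taylor_lipschitz phi (dphi : R -> R) (K : R) : 0 <= K ->
  (forall x, is_derive x 1 phi (dphi x)) ->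
  (forall x y, `|dphi x - dphi y| <= K * `|x - y|) ->
  forall x y, `|phi y - phi x - dphi x * (y - x)| <= K * (y - x) ^+ 2.
Proof.
move=> K0 dp lip x y.
have cphi (u v : R) : {within `[u, v], continuous phi}.
  apply: continuous_in_subspaceT => z _.
  apply: differentiable_continuous; apply/derivable1_diffP.
  by have [] := dp z.
have [z zx e] : exists2 z, `|z - x| <= `|y - x| & phi y - phi x = dphi z * (y - x).
  have [xy|yx] := leP x y.
    have [z /[!in_itv]/= /andP[xz zy] e] := MVT_segment xy (fun z _ => dp z) (cphi x y).
    by exists z => //; rewrite !ger0_norm ?subr_ge0// lerD2r.
  have [z /[!in_itv]/= /andP[yz zx] e] := MVT_segment (ltW yx) (fun z _ => dp z) (cphi y x).
  exists z; last by rewrite -(opprB (phi x)) e -mulrN opprB.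
  by rewrite !ler0_norm ?subr_le0// ?(ltW yx)// lerN2 lerD2r.
rewrite e -mulrBl normrM -(real_normK (num_real (y - x))) expr2 mulrA.
by rewrite ler_wpM2r// (le_trans (lip _ _))// ler_wpM2l.
Qed.

End stein_equation.

(** * Quadratic functionals of independent Poisson variables *)

Section poisson_vector.
Context d (Omega : measurableType d) (R : realType) (P : probability Omega R).
Context (I : finType) (N : I -> Omega -> nat) (lam : I -> R).
Hypothesis lam_ge0 : forall i, 0 <= lam i.
Hypothesis mN : forall i k, measurable (N i @^-1` [set k]).
(* For a law on the natural numbers this recursion characterizes the Poisson law of
   parameter [lam i]. *)
Hypothesis N_rec : forall i k,
  (k.+1%:R%:E * P (N i @^-1` [set k.+1]) = (lam i)%:E * P (N i @^-1` [set k]))%E.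
Hypothesis N_indep : forall nu : I -> nat,
  P (\bigcap_(i in [set: I]) (N i @^-1` [set nu i])) =
  (\prod_i P (N i @^-1` [set nu i]))%E.

Local Notation conf := {ffun I -> nat}.
Implicit Types (nu : conf) (G H : conf -> R).

Definition pvec (w : Omega) : conf := [ffun i => N i w].

Definition add_point nu i : conf := [ffun j => (nu j + (j == i))%N].

Lemma pvec_preimage1 nu :
  pvec @^-1` [set nu] = \bigcap_(i in [set: I]) (N i @^-1` [set nu i]).
Proof.
apply/seteqP; split => [w /= <- i _ /=|w /= wnu]; first by rewrite ffunE.
by apply/ffunP => i; rewrite ffunE; exact: wnu.
Qed.

Lemma measurable_pvec1 nu : measurable (pvec @^-1` [set nu]).
Proof.
rewrite pvec_preimage1; apply: fin_bigcap_measurable => // i _; exact: mN.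
Qed.

Lemma measurable_pvec (A : set conf) : measurable (pvec @^-1` A).
Proof.
rewrite (_ : _ @^-1` _ = \bigcup_nu
    (if nu \in A then pvec @^-1` [set nu] else set0)); last first.
  apply/seteqP; split => [w Aw|w [nu _]]; first by exists (pvec w); rewrite ?mem_set.
  by case: ifPn => // /set_mem Anu /= ->.
apply: countable_bigcupT_measurable; first exact: countableP.
by move=> nu; case: ifP => _; [exact: measurable_pvec1|exact: measurable0].
Qed.

Lemma measurable_fun_pvec d' (T : measurableType d') (f : conf -> T) :
  measurable_fun setT (f \o pvec).
Proof. by move=> _ A mA; rewrite setTI comp_preimage; exact: measurable_pvec. Qed.

(** There are countably many configurations, so Omega splits into countably many measurable fibres
    of [pvec], on each of which the integrand is constant. *)
Lemma integral_pvec G : (forall nu, 0 <= G nu) ->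
  (\int[P]_w (G (pvec w))%:E =
   \esum_(nu in [set: conf]) ((G nu)%:E * P (pvec @^-1` [set nu])))%E.
Proof.
(* Each J k is empty or a singleton, [pickle] being injective. *)
move=> G0; pose J k := [set nu : conf | choice.pickle nu = k].
pose F k := pvec @^-1` (J k).
have JT : \bigcup_k J k = setT.
  by apply/seteqP; split => // nu _; exists (choice.pickle nu).
have FT : \bigcup_k F k = setT.
  by apply/seteqP; split => // w _; exists (choice.pickle (pvec w)).
have tJ : trivIset setT J.
  by move=> k l _ _ [nu [/= <- <-]].
have tF : trivIset setT F.
  by move=> k l _ _ [w [/= <- <-]].
have a0 nu : (0 <= (G nu)%:E * P (pvec @^-1` [set nu]))%E.
  by rewrite mule_ge0// lee_fin.
rewrite -FT ge0_integral_bigcup//; first last.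
- by move=> w _; rewrite lee_fin.
- by rewrite FT; exact: (measurable_fun_pvec (EFin \o G)).
- by move=> k; exact: measurable_pvec.
rewrite nneseries_esumT; last by move=> k; apply: integral_ge0 => w _; rewrite lee_fin.
rewrite -JT esum_bigcupT//; apply: eq_esum => k _.
have [J0|/set0P[nu Jnu]] := eqVneq (J k) set0.
  by rewrite J0 esum_set0 /F J0 preimage_set0 integral_set0.
have JE : J k = [set nu].
  apply/seteqP; split => [mu /= Jmu|mu -> //].
  by apply: (pcan_inj choice.pickleK); rewrite Jmu.
rewrite /F JE esum_set1// -integral_cst; last exact: measurable_pvec1.
by apply: eq_integral => w /set_mem /= ->.
Qed.

(** Independence factors both probabilities; only the factor of index i differs, and there the
    Poisson recursion applies. *)
Lemma pvec_add_point nu i :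
  ((nu i).+1%:R%:E * P (pvec @^-1` [set add_point nu i]) =
   (lam i)%:E * P (pvec @^-1` [set nu]))%E.
Proof.
rewrite !pvec_preimage1 !N_indep (bigD1 i)//= [in RHS](bigD1 i)//= !muleA.
rewrite /add_point ffunE eqxx addn1 N_rec; congr (_ * _)%E.
by apply: eq_bigr => j /negbTE ji; rewrite ffunE ji addn0.
Qed.

(* The Slivnyak-Mecke formula. *)
Lemma mecke_ge0 G i : (forall nu, 0 <= G nu) ->
  (\int[P]_w ((pvec w i)%:R * G (pvec w))%:E =
   (lam i)%:E * \int[P]_w (G (add_point (pvec w) i))%:E)%E.
Proof.
move=> G0; rewrite -ge0_integralZl_EFin//; first last.
- exact: (measurable_fun_pvec (fun nu => (G (add_point nu i))%:E)).
- by move=> w _; rewrite lee_fin.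
rewrite (integral_pvec (G := fun nu => (nu i)%:R * G nu)); last first.
  by move=> nu; rewrite mulr_ge0.
under [RHS]eq_integral do rewrite -EFinM.
rewrite (integral_pvec (G := fun nu => lam i * G (add_point nu i))); last first.
  by move=> nu; rewrite mulr_ge0.
(* Configurations without a point at i contribute nothing; the others are exactly those obtained by
   adding a point at i. *)
rewrite (esumID [set nu : conf | (0 < nu i)%N]); last first.
  by move=> nu _; rewrite mule_ge0// lee_fin mulr_ge0.
rewrite !setTI [X in (_ + X)%E]esum1 ?adde0; last first.
  by move=> nu /= /negP; rewrite -leqNgt leqn0 => /eqP ->; rewrite mul0r mul0e.
rewrite (@reindex_esum _ _ _ setT _ (fun nu => add_point nu i)); last first.
  split.
  - by move=> nu _; rewrite /= ffunE eqxx addn1.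
  - move=> nu mu _ _ /ffunP e; apply/ffunP => j; have := e j.
    by rewrite !ffunE => /addIn.
  - move=> nu /= nui; exists [ffun j => (nu j - (j == i))%N] => //.
    apply/ffunP => j; rewrite !ffunE subnK//.
    by case: eqP => // ->.
apply: eq_esum => nu _; rewrite ffunE eqxx addn1 mulrC EFinM -muleA pvec_add_point.
by rewrite muleA -EFinM mulrC.
Qed.

Definition npts nu : nat := (\sum_i nu i)%N.

(* Polynomially bounded functionals have all moments and form an algebra stable under
   adding a point. *)
Definition pbounded G := exists C : R, exists2 p : nat, 0 <= C &
  forall nu, `|G nu| <= C * (1 + (npts nu)%:R) ^+ p.

Let npts1 nu : 1 <= 1 + (npts nu)%:R :> R.
Proof. by rewrite lerDl. Qed.

Let pow_ge1 nu p : 1 <= (1 + (npts nu)%:R) ^+ p :> R.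
Proof. exact: exprn_ege1. Qed.

Lemma pb_cst c : pbounded (fun=> c).
Proof. by exists `|c|, 0%N => // nu; rewrite expr0 mulr1. Qed.

Lemma pb_bounded G C : (forall nu, `|G nu| <= C) -> pbounded G.
Proof.
move=> GC; exists C, 0%N; last by move=> nu; rewrite expr0 mulr1.
by rewrite (le_trans _ (GC [ffun=> 0%N])).
Qed.

Lemma pb_coord i : pbounded (fun nu => (nu i)%:R).
Proof.
exists 1, 1%N => // nu; rewrite expr1 mul1r ger0_norm// -mulrS ler_nat.
by rewrite /npts (bigD1 i)//=; lia.
Qed.

Lemma pbD G H : pbounded G -> pbounded H -> pbounded (fun nu => G nu + H nu).
Proof.
move=> [C [p C0 GC]] [D [q D0 HD]]; exists (C + D), (p + q)%N; first exact: addr_ge0.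
move=> nu; rewrite (le_trans (ler_normD _ _))// mulrDl lerD//.
  by rewrite (le_trans (GC nu))// ler_wpM2l// ler_weXn2l// leq_addr.
by rewrite (le_trans (HD nu))// ler_wpM2l// ler_weXn2l// leq_addl.
Qed.

Lemma pbM G H : pbounded G -> pbounded H -> pbounded (fun nu => G nu * H nu).
Proof.
move=> [C [p C0 GC]] [D [q D0 HD]]; exists (C * D), (p + q)%N; first exact: mulr_ge0.
by move=> nu; rewrite normrM exprD mulrACA ler_pM.
Qed.

Lemma pbZ c G : pbounded G -> pbounded (fun nu => c * G nu).
Proof. by move=> bG; apply: pbM => //; exact: pb_cst. Qed.

Lemma pbN G : pbounded G -> pbounded (fun nu => - G nu).
Proof.
by move=> [C [p C0 GC]]; exists C, p => // nu; rewrite normrN.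
Qed.

Lemma pbB G H : pbounded G -> pbounded H -> pbounded (fun nu => G nu - H nu).
Proof. by move=> bG bH; apply: pbD => //; exact: pbN. Qed.

Lemma pbX G n : pbounded G -> pbounded (fun nu => G nu ^+ n).
Proof.
move=> bG; elim: n => [|n ih]; first exact: pb_cst.
rewrite (_ : (fun nu => _) = (fun nu => G nu * G nu ^+ n)); first exact: pbM.
by apply/funext => nu; rewrite exprS.
Qed.

Lemma pb_norm G : pbounded G -> pbounded (fun nu => `|G nu|).
Proof. by move=> [C [p C0 GC]]; exists C, p => // nu; rewrite normr_id. Qed.

Lemma pb_sum (J : finType) (F : J -> conf -> R) :
  (forall j, pbounded (F j)) -> pbounded (fun nu => \sum_j F j nu).
Proof.
move=> bF; elim: (index_enum J) => [|j s ih].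
  rewrite (_ : (fun nu => _) = (fun=> 0)); first exact: pb_cst.
  by apply/funext => nu; rewrite big_nil.
rewrite (_ : (fun nu => _) = (fun nu => F j nu + \sum_(i <- s) F i nu)).
  exact: pbD.
by apply/funext => nu; rewrite big_cons.
Qed.

Lemma npts_add_point nu i : npts (add_point nu i) = (npts nu).+1.
Proof.
rewrite /npts; under eq_bigr do rewrite ffunE.
rewrite big_split/= -addn1; congr addn.
by rewrite (bigD1 i)//= eqxx big1 ?addn0// => j /negbTE ->.
Qed.

Let two_pow nu p :
  (1 + (npts nu).+1%:R) ^+ p <= 2 ^+ p * (1 + (npts nu)%:R) ^+ p :> R.
Proof.
rewrite -exprMn lerXn2r ?nnegrE ?addr_ge0 ?mulr_ge0 ?addr_ge0//.
by rewrite -natr1; have : 0 <= (npts nu)%:R :> R by []; lra.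
Qed.

Lemma pb_add_point G i : pbounded G -> pbounded (fun nu => G (add_point nu i)).
Proof.
move=> [C [p C0 GC]]; exists (C * 2 ^+ p), p; first by rewrite mulr_ge0.
move=> nu; rewrite (le_trans (GC _))// npts_add_point -mulrA ler_wpM2l//.
Qed.

(** Induction on the power: one factor 1 + sum_i nu_i is expanded, and Mecke's formula turns the
    term of index i into the lower moment with one extra point, at most 2^p times the lower moment
    itself. *)
Lemma integrable_npts p :
  P.-integrable setT (fun w => ((1 + (npts (pvec w))%:R) ^+ p)%:E).
Proof.
have mF (f : conf -> R) : measurable_fun setT (fun w => (f (pvec w))%:E).
  exact: (measurable_fun_pvec (EFin \o f)).
elim: p => [|p ih].
  exact: (finite_measure_integrable_cst P 1).
have ihi i : P.-integrable setT
    (fun w => ((pvec w i)%:R * (1 + (npts (pvec w))%:R) ^+ p)%:E).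
  apply/integrableP; split.
    exact: (mF (fun nu => (nu i)%:R * (1 + (npts nu)%:R) ^+ p)).
  under eq_integral do rewrite gee0_abs ?lee_fin ?mulr_ge0 ?exprn_ge0 ?addr_ge0//.
  rewrite (mecke_ge0 (G := fun nu => (1 + (npts nu)%:R) ^+ p)); last first.
    by move=> nu; rewrite exprn_ge0// addr_ge0.
  apply: lte_mul_pinfty => //; first by rewrite lee_fin.
  apply: (@le_lt_trans _ _ (\int[P]_w ((2 ^+ p)%:E * ((1 + (npts (pvec w))%:R) ^+ p)%:E))%E).
    apply: ge0_le_integral => //.
    - exact: (mF (fun nu => (1 + (npts (add_point nu i))%:R) ^+ p)).
    - exact: (mF (fun nu => 2 ^+ p * (1 + (npts nu)%:R) ^+ p)).
    - by move=> w _; rewrite -EFinM lee_fin npts_add_point.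
  have := integrableZl measurableT (2 ^+ p) ih.
  move=> /integrableP[_]; under eq_integral.
    move=> w _; rewrite gee0_abs; last by rewrite mule_ge0// lee_fin exprn_ge0// addr_ge0.
    over.
  by [].
apply: (eq_integrable _ (fun w => ((1 + (npts (pvec w))%:R) ^+ p)%:E +
    \sum_i ((pvec w i)%:R * (1 + (npts (pvec w))%:R) ^+ p)%:E)%E) => //.
  move=> w _; rewrite sumEFin -EFinD; congr EFin.
  by rewrite exprS mulrDl mul1r -mulr_suml /npts natr_sum.
by apply: integrableD => //; exact: integrable_sum.
Qed.

Lemma integrable_pb G : pbounded G -> P.-integrable setT (EFin \o (G \o pvec)).
Proof.
move=> [C [p C0 GC]]; apply: (@le_integrable _ _ _ P _ _ _
    (fun w => C%:E * ((1 + (npts (pvec w))%:R) ^+ p)%:E)%E) => //.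
- exact: (measurable_fun_pvec (EFin \o G)).
- move=> w _; rewrite -EFinM !abse_EFin lee_fin (le_trans (GC _))//.
  exact: ler_norm.
- by apply: integrableZl => //; exact: integrable_npts.
Qed.

Definition Ex G : R := (\int[P]_w G (pvec w))%R.

Lemma eq_Ex G H : G =1 H -> Ex G = Ex H.
Proof. by move=> GH; apply: eq_Rintegral => w _; rewrite GH. Qed.

Lemma Ex_cst c : Ex (fun=> c) = c.
Proof. by rewrite /Ex /Rintegral integral_cst//= probability_setT mule1. Qed.

Lemma ExD G H : pbounded G -> pbounded H ->
  Ex (fun nu => G nu + H nu) = Ex G + Ex H.
Proof. by move=> /integrable_pb iG /integrable_pb iH; rewrite /Ex RintegralD. Qed.

Lemma ExB G H : pbounded G -> pbounded H ->
  Ex (fun nu => G nu - H nu) = Ex G - Ex H.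
Proof. by move=> /integrable_pb iG /integrable_pb iH; rewrite /Ex RintegralB. Qed.

Lemma ExZ c G : pbounded G -> Ex (fun nu => c * G nu) = c * Ex G.
Proof. by move=> /integrable_pb iG; rewrite /Ex RintegralZl. Qed.

Lemma Ex_sum (J : finType) (F : J -> conf -> R) : (forall j, pbounded (F j)) ->
  Ex (fun nu => \sum_j F j nu) = \sum_j Ex (F j).
Proof.
move=> bF; have bs (s : seq J) : pbounded (fun nu => \sum_(j <- s) F j nu) /\
    Ex (fun nu => \sum_(j <- s) F j nu) = \sum_(j <- s) Ex (F j).
  elim: s => [|j s [ihb ih]].
    rewrite (_ : (fun nu => _) = (fun=> 0)).
      by rewrite big_nil Ex_cst; split => //; exact: pb_cst.
    by apply/funext => nu; rewrite big_nil.
  rewrite (_ : (fun nu => _) = (fun nu => F j nu + \sum_(i <- s) F i nu)).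
    by rewrite big_cons ExD// ih; split => //; exact: pbD.
  by apply/funext => nu; rewrite big_cons.
exact: (bs _).2.
Qed.

Lemma le_Ex G H : pbounded G -> pbounded H -> (forall nu, G nu <= H nu) ->
  Ex G <= Ex H.
Proof. by move=> /integrable_pb iG /integrable_pb iH GH; apply: le_Rintegral. Qed.

Lemma le_norm_Ex G : pbounded G -> `|Ex G| <= Ex (fun nu => `|G nu|).
Proof. by move=> /integrable_pb iG; exact: le_normr_Rintegral. Qed.

(** G is the difference of the nonnegative functionals G + M and M, where M is the polynomial
    majorant of |G|. *)
Lemma mecke G i : pbounded G ->
  Ex (fun nu => (nu i)%:R * G nu) = lam i * Ex (fun nu => G (add_point nu i)).
Proof.
have ge0 H : pbounded H -> (forall nu, 0 <= H nu) ->
    Ex (fun nu => (nu i)%:R * H nu) = lam i * Ex (fun nu => H (add_point nu i)).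
  move=> bH H0; rewrite /Ex /Rintegral mecke_ge0// fineM//.
  exact: integrable_fin_num (integrable_pb (pb_add_point i bH)).
move=> bG; have [C [p C0 GC]] := bG.
pose M nu := C * (1 + (npts nu)%:R) ^+ p.
have bM : pbounded M.
  by exists C, p => // nu; rewrite ger0_norm// mulr_ge0// exprn_ge0// addr_ge0.
have bGM : pbounded (fun nu => G nu + M nu) by exact: pbD.
have -> : Ex (fun nu => (nu i)%:R * G nu) =
    Ex (fun nu => (nu i)%:R * (G nu + M nu)) - Ex (fun nu => (nu i)%:R * M nu).
  rewrite -ExB; try by apply: pbM => //; exact: pb_coord.
  by apply: eq_Ex => nu; ring.
rewrite !ge0//; first last.
- by move=> nu; rewrite -lerBlDr sub0r; have := GC nu; rewrite ler_norml => /andP[].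
- by move=> nu; rewrite mulr_ge0// exprn_ge0// addr_ge0.
rewrite -mulrBr -ExB; [|exact: (pb_add_point i bGM)|exact: pb_add_point].
by congr (_ * _); apply: eq_Ex => nu; rewrite addrK.
Qed.

Ltac pb_tac := repeat (first
  [ assumption | exact: pb_cst | exact: pb_coord
  | apply: pb_sum => ? | apply: pb_norm | apply: pbX
  | apply: pbD | apply: pbB | apply: pbM | apply: pbN | apply: pb_add_point]).

Definition linf (u : I -> R) nu : R := \sum_k u k * (nu k)%:R.

Lemma pb_linf u : pbounded (linf u).
Proof. by apply: pb_sum => k; pb_tac. Qed.

Lemma linf_add_point u nu i : linf u (add_point nu i) = linf u nu + u i.
Proof.
rewrite /linf; under eq_bigr do rewrite ffunE natrD mulrDr.
rewrite big_split/=; congr (_ + _).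
rewrite (bigD1 i)//= eqxx mulr1 big1 ?addr0// => j /negbTE ->.
by rewrite mulr0.
Qed.

Lemma Ex_linfM u G : pbounded G ->
  Ex (fun nu => linf u nu * G nu) =
  \sum_k u k * lam k * Ex (fun nu => G (add_point nu k)).
Proof.
move=> bG; rewrite (eq_Ex (H := fun nu => \sum_k u k * ((nu k)%:R * G nu))); last first.
  by move=> nu; rewrite /linf mulr_suml; apply: eq_bigr => k _; rewrite mulrA.
rewrite Ex_sum; last by move=> k; pb_tac.
by apply: eq_bigr => k _; rewrite ExZ ?mecke ?mulrA//; pb_tac.
Qed.

Definition meanf (u : I -> R) : R := \sum_k u k * lam k.

Lemma Ex_linf u : Ex (linf u) = meanf u.
Proof.
rewrite (eq_Ex (H := fun nu => linf u nu * 1)); last by move=> nu; rewrite mulr1.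
rewrite Ex_linfM; last exact: pb_cst.
by apply: eq_bigr => k _; rewrite Ex_cst mulr1.
Qed.

Lemma Ex_linf2 u : Ex (fun nu => linf u nu ^+ 2) =
  meanf u ^+ 2 + \sum_k u k ^+ 2 * lam k.
Proof.
have bu := pb_linf u.
rewrite Ex_linfM//.
transitivity (\sum_k (u k * lam k * meanf u + u k ^+ 2 * lam k)).
  apply: eq_bigr => k _; under eq_Ex do rewrite linf_add_point.
  rewrite ExD ?Ex_linf ?Ex_cst//; [ring|exact: pb_cst].
by rewrite big_split/= -mulr_suml.
Qed.

(** Since u takes only the values 0 and 1, this is the third moment of a Poisson variable of
    parameter [meanf u]. *)
Lemma Ex_linf3 u : (forall k, u k ^+ 2 = u k) ->
  Ex (fun nu => linf u nu ^+ 3) = meanf u ^+ 3 + 3 * meanf u ^+ 2 + meanf u.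
Proof.
move=> u2; have bu := pb_linf u.
have b2 : pbounded (fun nu => linf u nu ^+ 2) by exact: pbX.
rewrite (eq_Ex (H := fun nu => linf u nu * linf u nu ^+ 2)); last first.
  by move=> nu; rewrite -exprS.
rewrite Ex_linfM//.
have s2 : \sum_k u k ^+ 2 * lam k = meanf u.
  by apply: eq_bigr => k _; rewrite u2.
transitivity (\sum_k (u k * lam k) * (meanf u ^+ 2 + 3 * meanf u + 1)).
  apply: eq_bigr => k _.
  rewrite (eq_Ex (H := fun nu => linf u nu ^+ 2 + (2 * u k * linf u nu + u k ^+ 2))); last first.
    by move=> nu; rewrite linf_add_point; ring.
  rewrite ExD//; last by pb_tac.
  rewrite ExD; [|by pb_tac|by pb_tac].
  rewrite ExZ// Ex_cst Ex_linf Ex_linf2 s2.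
  have := u2 k => e; rewrite e.
  transitivity (u k * lam k * (meanf u ^+ 2 + meanf u) + (u k ^+ 2) * lam k * (2 * meanf u + 1)).
    by ring.
  by rewrite e; ring.
rewrite -mulr_suml -/(meanf u); ring.
Qed.

(** * The covariance identity for quadratic forms *)

Section quadratic_functional.
Variables (c : I -> I -> R) (b : I -> R).
Hypothesis c_sym : forall i j, c i j = c j i.

(** The sum of c over ordered pairs of distinct points plus the sum of b over points: subtracting c
    j j makes the diagonal contribute c j j nu_j (nu_j - 1). *)
Definition quadf nu : R :=
  \sum_j (nu j)%:R * (linf (c j) nu - c j j + b j).

Definition quad_mean : R := \sum_j lam j * (meanf (c j) + b j).

Lemma pb_quadf : pbounded quadf.
Proof. by apply: pb_sum => j; apply: pbM; pb_tac; exact: pb_linf. Qed.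

Lemma quadf_add_point nu i :
  quadf (add_point nu i) = quadf nu + (2 * linf (c i) nu + b i).
Proof.
have sE : \sum_j (nu j)%:R * c j i = linf (c i) nu.
  by apply: eq_bigr => j _; rewrite mulrC c_sym.
rewrite /quadf.
transitivity (\sum_j ((nu j)%:R * (linf (c j) nu - c j j + b j) + (nu j)%:R * c j i
   + (j == i)%:R * (linf (c j) nu + c j i - c j j + b j))).
  by apply: eq_bigr => j _; rewrite linf_add_point ffunE natrD; ring.
rewrite !big_split/= -addrA; congr (_ + _); rewrite sE.
rewrite (bigD1 i)//= eqxx mul1r big1 ?addr0; last first.
  by move=> j /negbTE ->; rewrite mul0r.
ring.
Qed.

(** Mecke's formula for each [linf (c j)], followed by an exchange of the two sums and the symmetry
    of c. It produces the cancellation behind the covariance identity. *)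
Lemma sum_linf_swap G : pbounded G ->
  \sum_j lam j * Ex (fun nu => linf (c j) nu * G nu) =
  \sum_j lam j * (meanf (c j) * Ex (fun nu => G (add_point nu j))).
Proof.
move=> bG; under eq_bigr do rewrite Ex_linfM// mulr_sumr.
rewrite exchange_big/=; apply: eq_bigr => k _.
rewrite /meanf mulr_suml mulr_sumr; apply: eq_bigr => j _.
by rewrite c_sym; ring.
Qed.

(* The weight of the discrete gradient is [-DL^{-1} quadf] in the
   Malliavin calculus on the Poisson space. *)
Lemma quadf_covariance G : pbounded G ->
  Ex (fun nu => quadf nu * G nu) - quad_mean * Ex G =
  \sum_j lam j * Ex (fun nu => (linf (c j) nu + meanf (c j) + b j) *
                              (G (add_point nu j) - G nu)).
Proof.
move=> bG; have bl j := pb_linf (c j).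
have bGj j : pbounded (fun nu => G (add_point nu j)) by exact: pb_add_point.
have -> : Ex (fun nu => quadf nu * G nu) = \sum_j lam j *
    Ex (fun nu => (linf (c j) nu + b j) * G (add_point nu j)).
  rewrite (eq_Ex (H := fun nu => \sum_j (nu j)%:R *
     ((linf (c j) nu - c j j + b j) * G nu))); last first.
    by move=> nu; rewrite mulr_suml; apply: eq_bigr => j _; rewrite mulrA.
  rewrite Ex_sum; last first.
    by move=> j; do !apply: pbM => //; pb_tac.
  apply: eq_bigr => j _; rewrite mecke; last by apply: pbM => //; pb_tac.
  congr (_ * _); apply: eq_Ex => nu; rewrite linf_add_point; ring.
have e j : Ex (fun nu => (linf (c j) nu + meanf (c j) + b j) *
                          (G (add_point nu j) - G nu)) =
   Ex (fun nu => (linf (c j) nu + b j) * G (add_point nu j)) +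
   meanf (c j) * Ex (fun nu => G (add_point nu j)) -
   Ex (fun nu => linf (c j) nu * G nu) - (meanf (c j) + b j) * Ex G.
  rewrite -!ExZ//.
  have b1 : pbounded (fun nu => (linf (c j) nu + b j) * G (add_point nu j)).
    by apply: pbM => //; pb_tac.
  have b2 : pbounded (fun nu => meanf (c j) * G (add_point nu j)) by exact: pbZ.
  have b3 : pbounded (fun nu => linf (c j) nu * G nu) by exact: pbM.
  have b4 : pbounded (fun nu => (meanf (c j) + b j) * G nu) by exact: pbZ.
  rewrite -ExD// -ExB//; last exact: pbD.
  rewrite -ExB//; last by apply: pbB => //; exact: pbD.
  by apply: eq_Ex => nu; ring.
under [RHS]eq_bigr do rewrite e mulrBr mulrBr mulrDr.
rewrite !sumrB big_split/= -sum_linf_swap// addrK /quad_mean mulr_suml.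
by congr (_ - _); apply: eq_bigr => j _; rewrite mulrA.
Qed.

Lemma Ex_quadf : Ex quadf = quad_mean.
Proof.
have := quadf_covariance (pb_cst 1); rewrite Ex_cst mulr1.
rewrite [RHS]big1; last first.
  move=> j _; rewrite (eq_Ex (H := fun=> 0)) ?Ex_cst ?mulr0// => nu.
  by rewrite subrr mulr0.
by move=> /eqP; rewrite subr_eq0 => /eqP <-; apply: eq_Ex => nu; rewrite mulr1.
Qed.

Definition quad_var : R := \sum_j lam j *
  ((2 * meanf (c j) + b j) ^+ 2 + 2 * \sum_k c j k ^+ 2 * lam k).

(** The term of index j in the covariance identity for G = [quadf], where adding a point at j
    changes G by 2 [linf (c j)] + b j. *)
Lemma Ex_quadf_weight j :
  Ex (fun nu => (linf (c j) nu + meanf (c j) + b j) * (2 * linf (c j) nu + b j)) =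
  (2 * meanf (c j) + b j) ^+ 2 + 2 * \sum_k c j k ^+ 2 * lam k.
Proof.
have bl := pb_linf (c j); have bl2 := pbX 2 bl.
rewrite (eq_Ex (H := fun nu => 2 * linf (c j) nu ^+ 2 +
  ((2 * meanf (c j) + 3 * b j) * linf (c j) nu + (meanf (c j) + b j) * b j))); last first.
  by move=> nu; ring.
rewrite ExD; [|exact: pbZ|by pb_tac].
rewrite ExD; [|exact: pbZ|exact: pb_cst].
rewrite (ExZ 2 bl2) (ExZ _ bl) Ex_cst Ex_linf Ex_linf2; ring.
Qed.

Lemma Ex_quadf_variance :
  Ex (fun nu => (quadf nu - quad_mean) ^+ 2) = quad_var.
Proof.
have bq := pb_quadf.
rewrite (eq_Ex (H := fun nu => quadf nu * quadf nu -
  (2 * quad_mean * quadf nu - quad_mean ^+ 2))); last first.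
  by move=> nu; ring.
rewrite ExB; [|exact: pbM|by pb_tac].
rewrite ExB; [|exact: pbZ|exact: pb_cst].
rewrite (ExZ _ bq) Ex_cst.
have := quadf_covariance bq; rewrite Ex_quadf => e.
rewrite (_ : _ - (_ - _) = Ex (fun nu => quadf nu * quadf nu) - quad_mean * quad_mean); last first.
  by ring.
rewrite e; apply: eq_bigr => j _; rewrite -Ex_quadf_weight; congr (_ * _).
by apply: eq_Ex => nu; rewrite quadf_add_point; ring.
Qed.

End quadratic_functional.

(** * Normal approximation of edge counts in a loopless graph on the indices *)

Section graph_functional.
Variable f : I -> I -> R.
Hypothesis f_sym : forall i j, f i j = f j i.
Hypothesis f_idem : forall i j, f i j ^+ 2 = f i j.
Hypothesis f_diag : forall i, f i i = 0.

Definition edge_count nu : R := \sum_j (nu j)%:R * linf (f j) nu.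

Let edge_countE nu : edge_count nu = quadf f (fun=> 0) nu.
Proof. by apply: eq_bigr => j _; rewrite f_diag subr0 addr0. Qed.

Definition edge_mean : R := \sum_j lam j * meanf (f j).

Definition edge_var : R := \sum_j lam j * (4 * meanf (f j) ^+ 2 + 2 * meanf (f j)).

Let edge_meanE : edge_mean = quad_mean f (fun=> 0).
Proof. by apply: eq_bigr => j _; rewrite addr0. Qed.

Let edge_varE : edge_var = quad_var f (fun=> 0).
Proof.
apply: eq_bigr => j _; congr (_ * _).
have -> : \sum_k f j k ^+ 2 * lam k = meanf (f j).
  by apply: eq_bigr => k _; rewrite f_idem.
ring.
Qed.

Lemma pb_edge_count : pbounded edge_count.
Proof. by apply: pb_sum => j; apply: pbM; pb_tac; exact: pb_linf. Qed.

Lemma Ex_edge_count : Ex edge_count = edge_mean.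
Proof. by rewrite edge_meanE -Ex_quadf//; exact: eq_Ex. Qed.

Lemma Ex_edge_count_variance :
  Ex (fun nu => (edge_count nu - edge_mean) ^+ 2) = edge_var.
Proof.
rewrite edge_varE -Ex_quadf_variance// edge_meanE.
by apply: eq_Ex => nu; rewrite edge_countE.
Qed.

Lemma edge_count_add_point nu i :
  edge_count (add_point nu i) = edge_count nu + 2 * linf (f i) nu.
Proof. by rewrite !edge_countE quadf_add_point// addr0. Qed.

Lemma edge_count_covariance G : pbounded G ->
  Ex (fun nu => edge_count nu * G nu) - edge_mean * Ex G =
  \sum_j lam j * Ex (fun nu => (linf (f j) nu + meanf (f j)) *
                              (G (add_point nu j) - G nu)).
Proof.
move=> bG; rewrite edge_meanE (eq_Ex (H := fun nu => quadf f (fun=> 0) nu * G nu)); last first.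
  by move=> nu; rewrite edge_countE.
rewrite quadf_covariance//; apply: eq_bigr => j _; congr (_ * _).
by apply: eq_Ex => nu; rewrite addr0.
Qed.

(** What the covariance identity leaves of phi (F) to first order: the weight times the increment 2
    [linf (f i)] of the edge count. Its mean is the variance, so its fluctuations control the
    distance to the normal law. *)
Definition stein_factor nu : R :=
  \sum_i lam i * ((linf (f i) nu + meanf (f i)) * (2 * linf (f i) nu)).

(** Coefficients that write [stein_factor] as a [quadf]. The summand 2 f i j of [bT] restores the
    diagonal [cT j j], which [quadf] subtracts. *)
Let cT j k : R := \sum_i 2 * lam i * f i j * f i k.
Let bT j : R := \sum_i lam i * (2 * meanf (f i) * f i j + 2 * f i j).

Let cT_sym j k : cT j k = cT k j.
Proof. by apply: eq_bigr => i _; ring. Qed.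

Let stein_factorE nu : stein_factor nu = quadf cT bT nu.
Proof.
transitivity (\sum_j (nu j)%:R * \sum_i 2 * lam i * f i j * (linf (f i) nu + meanf (f i))).
  under [RHS]eq_bigr do rewrite mulr_sumr.
  rewrite exchange_big/=; apply: eq_bigr => i _.
  rewrite {2}/linf !mulr_sumr; apply: eq_bigr => j _; ring.
apply: eq_bigr => j _; congr (_ * _).
have -> : linf (cT j) nu = \sum_i 2 * lam i * f i j * linf (f i) nu.
  rewrite /linf /cT; under eq_bigr do rewrite mulr_suml.
  rewrite exchange_big/=; apply: eq_bigr => i _.
  by rewrite mulr_sumr; apply: eq_bigr => k _; ring.
rewrite /cT /bT -addrA -sumrN -!big_split/=; apply: eq_bigr => i _.
by have := f_idem i j; rewrite expr2 => e; rewrite -!mulrA e; ring.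
Qed.

Lemma pb_stein_factor : pbounded stein_factor.
Proof. by apply: pb_sum => j; do !apply: pbM; pb_tac; exact: pb_linf. Qed.

Let Ex_stein_factor : Ex stein_factor = edge_var.
Proof.
rewrite Ex_sum; last by move=> j; do !apply: pbM; pb_tac; exact: pb_linf.
rewrite edge_varE; apply: eq_bigr => j _.
rewrite ExZ; last by do !apply: pbM; pb_tac; exact: pb_linf.
congr (_ * _); rewrite -(Ex_quadf_weight f (fun=> 0)).
by apply: eq_Ex => nu; rewrite !addr0.
Qed.

(** G bounds the expected number of neighbours of any index. The total intensity is bounded by a
    square, so that r has the scale of a standard deviation. *)
Variables (G r : R).
Hypothesis G_ge1 : 1 <= G.
Hypothesis gG : forall i, meanf (f i) <= G.
Hypothesis r_gt0 : 0 < r.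
Hypothesis lam_r : \sum_i lam i <= r ^+ 2.

Let f_ge0 i j : 0 <= f i j.
Proof. by rewrite -f_idem sqr_ge0. Qed.

Let g_ge0 i : 0 <= meanf (f i).
Proof. by apply: sumr_ge0 => k _; rewrite mulr_ge0. Qed.

Let G_ge0 : 0 <= G. Proof. exact: le_trans G_ge1. Qed.

Let sum_lam_f_le j : \sum_i lam i * f i j <= G.
Proof.
rewrite (le_trans _ (gG j))// /meanf le_eqVlt; apply/orP; left; apply/eqP.
by apply: eq_bigr => i _; rewrite f_sym mulrC.
Qed.

Let cT_ge0 j k : 0 <= cT j k.
Proof. by apply: sumr_ge0 => i _; rewrite !mulr_ge0. Qed.

Let f_le1 i j : f i j <= 1.
Proof. by have := f_idem i j; have := f_ge0 i j; nra. Qed.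

Let cT_le j k : cT j k <= 2 * G.
Proof.
apply: (@le_trans _ _ (2 * \sum_i lam i * f i j)); last by rewrite ler_wpM2l.
rewrite mulr_sumr ler_sum// => i _; rewrite -!mulrA !ler_wpM2l//.
by rewrite ler_piMr.
Qed.

Let meanf_cT_le j : meanf (cT j) <= 2 * G ^+ 2.
Proof.
have -> : meanf (cT j) = \sum_i 2 * lam i * f i j * meanf (f i).
  rewrite /meanf /cT; under eq_bigr do rewrite mulr_suml.
  rewrite exchange_big/=; apply: eq_bigr => i _.
  by rewrite mulr_sumr; apply: eq_bigr => k _; ring.
apply: (@le_trans _ _ (2 * (\sum_i lam i * f i j) * G)); last first.
  by rewrite expr2 mulrA ler_wpM2r// ler_wpM2l.
rewrite mulr_sumr mulr_suml ler_sum// => i _; rewrite -!mulrA !ler_wpM2l//.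
Qed.

Let meanf_cT_ge0 j : 0 <= meanf (cT j).
Proof. by apply: sumr_ge0 => k _; rewrite mulr_ge0. Qed.

Let bT_ge0 j : 0 <= bT j.
Proof. by apply: sumr_ge0 => i _; rewrite !(mulr_ge0, addr_ge0). Qed.

Let bT_le j : bT j <= 4 * G ^+ 2.
Proof.
apply: (@le_trans _ _ (\sum_i lam i * f i j * (4 * G))).
  apply: ler_sum => i _; rewrite -[leRHS]mulrA ler_wpM2l//.
  have := gG i; have := f_ge0 i j; have := f_le1 i j; have := G_ge1; nra.
by rewrite -mulr_suml expr2; have := sum_lam_f_le j; have := G_ge0; nra.
Qed.

Lemma quad_var_stein_factor_le : quad_var cT bT <= 72 * r ^+ 2 * G ^+ 4.
Proof.
apply: (@le_trans _ _ (\sum_j lam j * (72 * G ^+ 4))); last first.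
  by rewrite -mulr_suml mulrCA mulrA ler_wpM2r ?exprn_ge0// ler_wpM2l.
apply: ler_sum => j _; rewrite ler_wpM2l//.
(* 8 = 2 * 2 + 4 from the bounds on [meanf (cT j)] and [bT j]. The other summand comes from sum_k
   cT^2 lam <= (max cT) [meanf (cT j)] <= 4 G^3, where G >= 1 allows the fourth power. *)
have -> : 72 * G ^+ 4 = (8 * G ^+ 2) ^+ 2 + 2 * (4 * G ^+ 4) by ring.
rewrite lerD//.
  rewrite lerXn2r ?nnegrE ?addr_ge0 ?mulr_ge0 ?exprn_ge0//.
  by have := meanf_cT_le j; have := bT_le j; lra.
rewrite ler_wpM2l//.
apply: (@le_trans _ _ (2 * G * meanf (cT j))).
  rewrite mulr_sumr ler_sum// => k _; rewrite mulrA ler_wpM2r// expr2.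
  by rewrite ler_wpM2r.
apply: (@le_trans _ _ (2 * G * (2 * G ^+ 2))); first by rewrite ler_wpM2l ?mulr_ge0.
rewrite (_ : 2 * G * (2 * G ^+ 2) = 4 * G ^+ 3); last by ring.
by rewrite ler_wpM2l// ler_weXn2l.
Qed.

(** In place of the Cauchy-Schwarz inequality, |x| <= x^2 / (2 t) + t / 2 with t = r G^2. The
    variance bound gives 36 t + t / 2, rounded up to 37 t. *)
Lemma Ex_stein_factor_dist :
  Ex (fun nu => `|stein_factor nu - edge_var|) <= 37 * r * G ^+ 2.
Proof.
have bT0 := pb_stein_factor.
pose t := r * G ^+ 2.
have t0 : 0 < t by rewrite mulr_gt0// exprn_gt0// (lt_le_trans _ G_ge1).
have b2 : pbounded (fun nu => (stein_factor nu - edge_var) ^+ 2) by apply: pbX; pb_tac.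
have mE : edge_var = quad_mean cT bT.
  by rewrite -Ex_stein_factor -Ex_quadf//; exact: eq_Ex.
have vE : Ex (fun nu => (stein_factor nu - edge_var) ^+ 2) = quad_var cT bT.
  by rewrite mE -Ex_quadf_variance//; apply: eq_Ex => nu; rewrite stein_factorE.
apply: (@le_trans _ _ (Ex (fun nu => (2 * t)^-1 * (stein_factor nu - edge_var) ^+ 2 + t / 2))).
  apply: le_Ex; [by pb_tac|by apply: pbD; pb_tac|move=> nu].
  set x := stein_factor nu - edge_var.
  rewrite -subr_ge0.
  have -> : (2 * t)^-1 * x ^+ 2 + t / 2 - `|x| = (2 * t)^-1 * (`|x| - t) ^+ 2.
    by rewrite -(real_normK (num_real x)); field; rewrite gt_eqF.
  by rewrite mulr_ge0 ?sqr_ge0// invr_ge0 mulr_ge0// ltW.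
rewrite ExD; [|exact: pbZ|exact: pb_cst].
rewrite (ExZ _ b2) Ex_cst vE.
have vle := quad_var_stein_factor_le.
apply: (@le_trans _ _ ((2 * t)^-1 * (72 * r ^+ 2 * G ^+ 4) + t / 2)).
  by rewrite lerD2r ler_wpM2l// invr_ge0 mulr_ge0// ltW.
have G0 : G != 0 by rewrite gt_eqF// (lt_le_trans _ G_ge1).
have -> : (2 * t)^-1 * (72 * r ^+ 2 * G ^+ 4) = 36 * t.
  by rewrite /t; field; rewrite G0 gt_eqF.
by rewrite -mulrA -/t; lra.
Qed.

(** With g = [meanf (f i)], Poisson moments give 2 g^3 + 4 g^2 + g, and 7 is the sum of the
    coefficients, as g <= G and G >= 1. *)
Lemma Ex_third_order i :
  Ex (fun nu => (linf (f i) nu + meanf (f i)) * linf (f i) nu ^+ 2) <= 7 * G ^+ 3.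
Proof.
have bl := pb_linf (f i).
rewrite (eq_Ex (H := fun nu => linf (f i) nu ^+ 3 + meanf (f i) * linf (f i) nu ^+ 2)); last first.
  by move=> nu; ring.
rewrite ExD; [|exact: pbX|by apply: pbZ; exact: pbX].
rewrite ExZ; last exact: pbX.
rewrite Ex_linf3// Ex_linf2.
have -> : \sum_k f i k ^+ 2 * lam k = meanf (f i).
  by apply: eq_bigr => k _; rewrite f_idem.
have := gG i; have := g_ge0 i; set g := meanf (f i) => g0 gG1.
have g1 : g <= G ^+ 3 by rewrite (le_trans gG1)// ler_eXnr.
have g2 : g ^+ 2 <= G ^+ 3.
  apply: (@le_trans _ _ (G ^+ 2)); last by rewrite ler_weXn2l.
  by rewrite lerXn2r.
have g3 : g ^+ 3 <= G ^+ 3 by rewrite lerXn2r.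
have -> : g ^+ 3 + 3 * g ^+ 2 + g + g * (g ^+ 2 + g) = 2 * g ^+ 3 + 4 * g ^+ 2 + g by ring.
lra.
Qed.

(** The scale sigma is left free, because the discretized counts will be normalized by the standard
    deviation of their limit; the mismatch is the term |sigma^2 - edge_var|. *)
Lemma edge_count_normal_approx (h phi dphi : R -> R) (K sigma : R) :
  0 < sigma ->
  (forall x : R, is_derive x 1 phi (dphi x)) ->
  (forall x : R, dphi x - x * phi x = h x - normal_mean h) ->
  (forall x : R, `|phi x| <= K) -> (forall x : R, `|dphi x| <= K) ->
  (forall x y : R, `|dphi x - dphi y| <= K * `|x - y|) ->
  `|Ex (fun nu => h ((edge_count nu - edge_mean) / sigma)) - normal_mean h| <=
  K * (`|sigma ^+ 2 - edge_var| + 37 * r * G ^+ 2) / sigma ^+ 2 +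
  28 * K * r ^+ 2 * G ^+ 3 / sigma ^+ 3.
Proof.
move=> sigma0 dp steinE phiK dphiK dphi_lip.
have K0 : 0 <= K by exact: le_trans (phiK 0).
have sn0 : sigma != 0 by rewrite gt_eqF.
pose U nu := (edge_count nu - edge_mean) / sigma.
have bS := pb_edge_count; have bT0 := pb_stein_factor.
have bl i := pb_linf (f i).
have bU : pbounded U by pb_tac.
have bphi : pbounded (fun nu => phi (U nu)) by exact: pb_bounded (fun nu => phiK _).
have bdphi : pbounded (fun nu => dphi (U nu)) by exact: pb_bounded (fun nu => dphiK _).
pose rem i nu := phi (U (add_point nu i)) - phi (U nu) -
  dphi (U nu) * (2 * linf (f i) nu / sigma).
have brem i : pbounded (rem i).
  apply: pbB; last by pb_tac.
  by apply: pbB => //; exact: (pb_add_point i bphi).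
(* The increment of U is 2 [linf (f i)] / sigma; its square accounts for the factor 4. *)
have rem_le i nu : `|rem i nu| <= 4 * K / sigma ^+ 2 * linf (f i) nu ^+ 2.
  have UE : U (add_point nu i) - U nu = 2 * linf (f i) nu / sigma.
    by rewrite /U edge_count_add_point; field.
  rewrite /rem -UE (le_trans (taylor_lipschitz K0 dp dphi_lip _ _))// UE.
  by rewrite le_eqVlt; apply/orP; left; apply/eqP; field.
have covE : Ex (fun nu => U nu * phi (U nu)) =
  sigma^-1 * \sum_j lam j * Ex (fun nu => (linf (f j) nu + meanf (f j)) *
                   (phi (U (add_point nu j)) - phi (U nu))).
  rewrite -(edge_count_covariance bphi) -(ExZ edge_mean bphi) -ExB; [|exact: pbM|exact: pbZ].
  rewrite -ExZ; last by apply: pbB; [exact: pbM|exact: pbZ].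
  by apply: eq_Ex => nu; rewrite {1}/U; field.
pose rest := \sum_j lam j * Ex (fun nu => (linf (f j) nu + meanf (f j)) * rem j nu).
have main : Ex (fun nu => U nu * phi (U nu)) =
    sigma ^- 2 * Ex (fun nu => stein_factor nu * dphi (U nu)) + sigma^-1 * rest.
  rewrite covE.
  have -> : Ex (fun nu => stein_factor nu * dphi (U nu)) = \sum_j lam j *
      Ex (fun nu => (linf (f j) nu + meanf (f j)) * (2 * linf (f j) nu) * dphi (U nu)).
    rewrite (eq_Ex (H := fun nu => \sum_j lam j * ((linf (f j) nu + meanf (f j)) *
        (2 * linf (f j) nu) * dphi (U nu)))); last first.
      by move=> nu; rewrite /stein_factor mulr_suml; apply: eq_bigr => j _; ring.
    rewrite Ex_sum; last by move=> j; pb_tac.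
    by apply: eq_bigr => j _; rewrite ExZ//; pb_tac.
  rewrite expr2 invfM -mulrA -mulrDr; congr (_ * _).
  rewrite mulr_sumr /rest -big_split/=.
  apply: eq_bigr => j _; rewrite mulrCA -mulrDr; congr (_ * _).
  rewrite -ExZ; last by pb_tac.
  rewrite -ExD; [|by pb_tac|by apply: pbM => //; pb_tac].
  by apply: eq_Ex => nu; rewrite /rem; field.
(* 28 = 4 * 7: the factor in [rem_le] times the constant of [Ex_third_order]. *)
have rest_le : `|rest| <= 28 * K * r ^+ 2 * G ^+ 3 / sigma ^+ 2.
  rewrite (le_trans (ler_norm_sum _ _ _))//.
  apply: (@le_trans _ _ (\sum_j lam j * (28 * K * G ^+ 3 / sigma ^+ 2))); last first.
    rewrite -mulr_suml.
    have -> : 28 * K * r ^+ 2 * G ^+ 3 / sigma ^+ 2 =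
        r ^+ 2 * (28 * K * G ^+ 3 / sigma ^+ 2) by field.
    rewrite ler_wpM2r// divr_ge0 ?mulr_ge0 ?exprn_ge0// ltW//.
  apply: ler_sum => j _; rewrite normrM ger0_norm// ler_wpM2l//.
  have b1 : pbounded (fun nu => (linf (f j) nu + meanf (f j)) * rem j nu).
    by apply: pbM => //; pb_tac.
  have b2 : pbounded (fun nu => (linf (f j) nu + meanf (f j)) * linf (f j) nu ^+ 2).
    by pb_tac.
  rewrite (le_trans (le_norm_Ex b1))//.
  apply: (@le_trans _ _ (Ex (fun nu => 4 * K / sigma ^+ 2 *
      ((linf (f j) nu + meanf (f j)) * linf (f j) nu ^+ 2)))).
    apply: le_Ex; [exact: pb_norm|exact: pbZ|move=> nu].
    have F0 : 0 <= linf (f j) nu + meanf (f j).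
      by rewrite addr_ge0// sumr_ge0// => k _; rewrite mulr_ge0.
    by rewrite normrM ger0_norm// mulrCA ler_wpM2l.
  rewrite ExZ//; have := Ex_third_order j => e3.
  apply: (@le_trans _ _ (4 * K / sigma ^+ 2 * (7 * G ^+ 3))).
    by rewrite ler_wpM2l// divr_ge0 ?mulr_ge0 ?exprn_ge0// ltW.
  by rewrite le_eqVlt; apply/orP; left; apply/eqP; field.
(* Stein's equation replaces h (U) - E h (Z) by dphi (U) - U phi (U), and [main] expands the second
   term. *)
have -> : Ex (fun nu => h ((edge_count nu - edge_mean) / sigma)) - normal_mean h =
    Ex (fun nu => dphi (U nu) * (sigma ^- 2 * (sigma ^+ 2 - stein_factor nu))) - sigma^-1 * rest.
  rewrite -[X in _ - X]Ex_cst -ExB; [| |exact: pb_cst]; last first.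
    rewrite (_ : (fun nu => _) = (fun nu => dphi (U nu) - U nu * phi (U nu) + normal_mean h)).
      by pb_tac.
    by apply/funext => nu; rewrite steinE subrK.
  rewrite (eq_Ex (H := fun nu => dphi (U nu) - U nu * phi (U nu))); last first.
    by move=> nu; rewrite steinE.
  rewrite ExB//; last exact: pbM.
  rewrite main opprD addrA; congr (_ - _).
  rewrite -ExZ; last exact: pbM.
  rewrite -ExB//; last by apply: pbZ; exact: pbM.
  by apply: eq_Ex => nu; field.
rewrite (le_trans (ler_normB _ _))// lerD//; last first.
  rewrite normrM gtr0_norm ?invr_gt0//.
  apply: (@le_trans _ _ (sigma^-1 * (28 * K * r ^+ 2 * G ^+ 3 / sigma ^+ 2))).
    by rewrite ler_wpM2l// invr_ge0 ltW.
  by rewrite le_eqVlt; apply/orP; left; apply/eqP; field.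
have b1 : pbounded (fun nu => dphi (U nu) * (sigma ^- 2 * (sigma ^+ 2 - stein_factor nu))).
  by pb_tac.
have b2 : pbounded (fun nu => `|stein_factor nu - edge_var|).
  by apply: pb_norm; pb_tac.
rewrite (le_trans (le_norm_Ex b1))//.
apply: (@le_trans _ _ (Ex (fun nu => K / sigma ^+ 2 *
    (`|sigma ^+ 2 - edge_var| + `|stein_factor nu - edge_var|)))).
  apply: le_Ex; [exact: pb_norm|by pb_tac|move=> nu].
  have s20 : 0 < sigma ^- 2 by rewrite invr_gt0 exprn_gt0.
  rewrite !normrM (gtr0_norm s20) -mulrA ler_pM//; first by rewrite mulr_ge0// ltW.
  rewrite ler_wpM2l ?(ltW s20)//.
  have -> : sigma ^+ 2 - stein_factor nu = (sigma ^+ 2 - edge_var) - (stein_factor nu - edge_var).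
    by ring.
  exact: ler_normB.
rewrite ExZ; last by pb_tac.
rewrite ExD//; last exact: pb_cst.
rewrite Ex_cst mulrAC ler_wpM2r ?invr_ge0 ?exprn_ge0 ?(ltW sigma0)// ler_wpM2l//.
by rewrite lerD2l; exact: Ex_stein_factor_dist.
Qed.

End graph_functional.
End poisson_vector.

(** * Discretization of the inversion relation *)

Section lebesgue_tuple_box.
Context {R : realType}.
Local Notation mu := (@lebesgue_measure R).

Definition box (J : nat -> set R) n : set (n.-tuple R) :=
  [set t | forall i : 'I_n, J i (tnth t i)].
Arguments box J n : clear implicits.

Lemma measurable_box n (J : nat -> set R) :
  (forall k, measurable (J k)) -> measurable (box J n).
Proof.
move=> mJ; rewrite (_ : box J n = \bigcap_(i in [set: 'I_n])
    ((fun t => tnth t i) @^-1` J i)); last first.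
  by apply/seteqP; split=> [t Jt i _|t Jt i]; exact: Jt.
apply: fin_bigcap_measurable => // i _.
by rewrite -[X in measurable X]setTI; apply: measurable_tnth.
Qed.

Lemma lebesgue_tuple_box n (J : nat -> set R) :
  (forall k, measurable (J k)) ->
  (lebesgue_tuple R n (box J n) = \prod_(i < n) mu (J i))%E.
Proof.
elim: n J => [|n ih] J mJ.
  rewrite big_ord0 /= diracE mem_set//; by case.
rewrite big_ord_recl/= -(ih (fun k => J k.+1))//.
rewrite /cons_measure /pushforward.
rewrite (_ : @cons_pair R n @^-1` _ = J 0%N `*` box (fun k => J k.+1) n); last first.
  apply/seteqP; split=> [[x t] /= Jt|[x t] [/= J0 Jt] i].
    split; first exact: (Jt ord0).
    by move=> i; have := Jt (lift ord0 i); rewrite tnthS.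
  have [j ->|-> //] := unliftP ord0 i.
  by rewrite /= tnthS; exact: Jt.
have mbox : measurable (box (fun k => J k.+1) n) by exact: measurable_box.
exact: (product_measure1E mu (lebesgue_tuple R n) (mJ 0%N) mbox).
Qed.

End lebesgue_tuple_box.
Arguments box {R} J n : rename.

(** * Combinatorics of the grid of cells *)

Section grid.
Local Open Scope nat_scope.

(* Cells are indexed by (location, lifetime), in units of the mesh. [nests i j i' j']
   holds when every point of the cell (i, j) is born strictly before, and dies strictly
   after, every point of the cell (i', j'), whose lifetimes moreover must not vanish. *)
Definition nests (i j i' j' : nat) : bool :=
  [&& i < i', i' + j' + 2 <= i + j & 0 < j'].

Definition linked (i j i' j' : nat) : bool := nests i j i' j' || nests i' j' i j.

Lemma linkedC i j i' j' : linked i j i' j' = linked i' j' i j.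
Proof. by rewrite /linked orbC. Qed.

Lemma linked_diag i j : linked i j i j = false.
Proof. by rewrite /linked /nests ltnn. Qed.

(** Of two nested lifetimes the later one starts before the earlier one ends, hence less than one
    time unit, or m columns, after it. *)
Lemma linked_near m i j i' j' : j < m -> j' < m -> linked i j i' j' ->
  i < i' + m /\ i' < i + m.
Proof. by rewrite /linked /nests => ? ? /orP[] /and3P[]; lia. Qed.

Lemma sum_ord_itv N a b : \sum_(i < N) ((a <= i) && (i < b) : nat) = minn N b - a.
Proof.
elim: N => [|N ih]; first by rewrite big_ord0; lia.
by rewrite big_ord_recr/= ih; case: leqP => /=; case: ltnP => /=; lia.
Qed.

End grid.

Lemma natr_sum_ord_itv (R : pzSemiRingType) N a b :
  \sum_(i < N) (((a <= i) && (i < b))%N)%:R = (minn N b - a)%:R :> R.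
Proof. by rewrite -natr_sum sum_ord_itv. Qed.

Section grid_bounds.
Context {R : realType} (n m : nat) (K : R) (lam : 'I_(n * m).+1 * 'I_m -> R).
Hypotheses (n_gt0 : (0 < n)%N) (m_gt0 : (0 < m)%N) (K_ge0 : 0 <= K).
Hypothesis lam_ge0 : forall p, 0 <= lam p.
Hypothesis lam_le : forall p, lam p <= K / (m%:R ^+ 2).
Hypothesis lam_eq : forall p : 'I_(n * m).+1 * 'I_m, (p.1 < n * m)%N -> lam p = K / (m%:R ^+ 2).
Implicit Types p q : ('I_(n * m).+1 * 'I_m)%type.

Definition link p q : R := (linked p.1 p.2 q.1 q.2)%:R.

Lemma linkC p q : link p q = link q p.
Proof. by rewrite /link linkedC. Qed.

Lemma link_idem p q : link p q ^+ 2 = link p q.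
Proof. by rewrite /link; case: linked; rewrite ?expr1n ?expr0n. Qed.

Lemma link_diag p : link p p = 0.
Proof. by rewrite /link linked_diag. Qed.

Let m0 : (m%:R : R) != 0. Proof. by rewrite pnatr_eq0 -lt0n. Qed.

Let Km_ge0 : 0 <= K / m%:R ^+ 2.
Proof. by rewrite divr_ge0// exprn_ge0. Qed.

(** The location n has index n m, so there are n m + 1 columns; the factor 2 absorbs the last
    one. *)
Lemma sum_lam_le : \sum_p lam p <= 2 * (n%:R * K).
Proof.
apply: (@le_trans _ _ (\sum_(p : 'I_(n * m).+1 * 'I_m) K / m%:R ^+ 2)).
  exact: ler_sum.
rewrite sumr_const card_prod !card_ord -[_ *+ _]mulr_natr.
have -> : 2 * (n%:R * K) = K / m%:R ^+ 2 * (2 * n * m * m)%:R.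
  by rewrite !natrM; field.
by rewrite ler_wpM2l// ler_nat; nia.
Qed.

(** By [linked_near] the cells linked to p lie in at most 2 m columns, each of total intensity at
    most K / m. *)
Lemma meanf_link_le p : meanf lam (link p) <= 2 * K.
Proof.
apply: (@le_trans _ _ (\sum_(q : 'I_(n * m).+1 * 'I_m)
   (((p.1 - m <= q.1) && (q.1 < p.1 + m))%N)%:R * (K / m%:R ^+ 2))).
  apply: ler_sum => q _; rewrite ler_pM//.
  rewrite /link ler_nat; case lk : linked => //.
  have [] := linked_near (ltn_ord p.2) (ltn_ord q.2) lk.
  by case: leqP => /=; case: ltnP => //=; lia.
rewrite -(pair_bigA _ (fun (i : 'I_(n * m).+1) (j : 'I_m) =>
  (((p.1 - m <= i) && (i < p.1 + m))%N)%:R * (K / m%:R ^+ 2)))/=.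
under eq_bigr do rewrite sumr_const card_ord -[_ *+ _]mulr_natr -mulrA.
rewrite -mulr_suml natr_sum_ord_itv.
have -> : 2 * K = (2 * m)%:R * (K / m%:R ^+ 2 * m%:R).
  by rewrite natrM; field.
by rewrite ler_wpM2r ?mulr_ge0// ler_nat; lia.
Qed.

End grid_bounds.

Section grid_variance.
Context {R : realType} (n s : nat) (K : R)
  (lam : 'I_(n * (4 * s)).+1 * 'I_(4 * s) -> R).
Hypotheses (n_gt0 : (0 < n)%N) (s_gt1 : (1 < s)%N) (K_ge0 : 0 <= K).
Hypothesis lam_ge0 : forall p, 0 <= lam p.
Hypothesis lam_eq : forall p : 'I_(n * (4 * s)).+1 * 'I_(4 * s), (p.1 < n * (4 * s))%N ->
  lam p = K / ((4 * s)%:R ^+ 2).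

Local Notation N := (n * (4 * s)).+1.
Local Notation M := (4 * s)%N.

Let s0 : (s%:R : R) != 0. Proof. by rewrite pnatr_eq0; lia. Qed.

Let lamE : K / ((4 * s)%:R ^+ 2) = K / (16 * s%:R ^+ 2).
Proof. by rewrite natrM; field. Qed.

Let C_ge0 : 0 <= K / (16 * s%:R ^+ 2).
Proof. by rewrite divr_ge0// mulr_ge0// exprn_ge0. Qed.

(** The s columns following p and the lifetime indices 1 to s form a block of s^2 cells of intensity
    K / (16 s^2), all nested in p: i' + j' + 2 <= p.1 + 2 s + 2 <= p.1 + 3 s because s >= 2. *)
Lemma meanf_link_ge (p : 'I_N * 'I_M) :
  (p.1 + s < n * M)%N -> (3 * s <= p.2)%N -> K / 16 <= meanf lam (link p).
Proof.
case: p => p1 p2 /= Hp1 Hp2.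
apply: (@le_trans _ _ (\sum_(q : 'I_N * 'I_M)
   (((p1.+1 <= q.1) && (q.1 < p1.+1 + s))%N)%:R *
   ((((1 <= q.2) && (q.2 < s.+1))%N)%:R * (K / (16 * s%:R ^+ 2))))); last first.
  apply: ler_sum => -[qi qj] _ /=.
  case: (boolP ((p1 < qi) && (qi < p1.+1 + s))%N) => [/andP[q1 q1']|_]; last first.
    by rewrite mul0r mulr_ge0.
  case: (boolP ((0 < qj) && (qj < s.+1))%N) => [/andP[q2 q2']|_]; last first.
    by rewrite mul0r mulr0 mulr_ge0.
  have q1n : (qi < n * M)%N by lia.
  rewrite !mul1r (lam_eq (p := (qi, qj)) q1n) lamE.
  rewrite -[leLHS]mul1r ler_wpM2r// /link ler1n lt0b /linked /nests/=.
  by apply/orP; left; apply/and3P; split; lia.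
rewrite -(pair_bigA _ (fun (i : 'I_N) (j : 'I_M) =>
  (((p1.+1 <= i) && (i < p1.+1 + s))%N)%:R *
   ((((1 <= j) && (j < s.+1))%N)%:R * (K / (16 * s%:R ^+ 2)))))/=.
under eq_bigr do rewrite -mulr_sumr -mulr_suml natr_sum_ord_itv.
rewrite -mulr_suml natr_sum_ord_itv.
have -> : (minn N (p1.+1 + s) - p1.+1 = s)%N by lia.
have -> : (minn M s.+1 - 1 = s)%N by lia.
by rewrite le_eqVlt; apply/orP; left; apply/eqP; field.
Qed.

(* Of the points p only those with location at most 3n/4 and lifetime at least 3/4
   are kept: the expected number of points linked to each of them is at least K / 16. *)
Lemma edge_var_link_ge : 3 / 1024 * (n%:R * K ^+ 3) <= edge_var lam (@link R n M).
Proof.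
apply: (@le_trans _ _ (\sum_(p : 'I_N * 'I_M)
   (((0 <= p.1) && (p.1 < 3 * n * s))%N)%:R *
   ((((3 * s <= p.2) && (p.2 < M))%N)%:R *
    (K / (16 * s%:R ^+ 2) * (4 * (K / 16) ^+ 2))))); last first.
  have g0 p : 0 <= meanf lam (@link R n M p).
    by apply: sumr_ge0 => q _; rewrite mulr_ge0// /link.
  apply: ler_sum => -[pi pj] _ /=.
  have v0 : 0 <= lam (pi, pj) * (4 * meanf lam (@link R n M (pi, pj)) ^+ 2 +
      2 * meanf lam (@link R n M (pi, pj))).
    by rewrite mulr_ge0// addr_ge0 ?mulr_ge0 ?exprn_ge0.
  case: (boolP (pi < 3 * n * s)%N) => [q1|_]; last first.
    by rewrite mul0r.
  case: (boolP ((3 * s <= pj) && (pj < M))%N) => [/andP[q2 q2']|_]; last first.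
    by rewrite mul0r mulr0.
  have p1n : ((pi : nat) < n * M)%N by nia.
  rewrite !mul1r (lam_eq (p := (pi, pj)) p1n) lamE.
  rewrite ler_wpM2l// -[leLHS]addr0 lerD ?mulr_ge0// ler_wpM2l//.
  rewrite lerXn2r ?nnegrE ?divr_ge0//.
  by apply: meanf_link_ge => //=; nia.
(* The block has 3 n s columns and s rows, and 3 n s^2 * K / (16 s^2) * 4 (K / 16)^2 = 3 n K^3 /
   1024. *)
rewrite -(pair_bigA _ (fun (i : 'I_N) (j : 'I_M) =>
  (((0 <= i) && (i < 3 * n * s))%N)%:R *
   ((((3 * s <= j) && (j < M))%N)%:R *
    (K / (16 * s%:R ^+ 2) * (4 * (K / 16) ^+ 2)))))/=.
under eq_bigr do rewrite -mulr_sumr -mulr_suml natr_sum_ord_itv.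
rewrite -mulr_suml (natr_sum_ord_itv R N 0).
have -> : (minn N (3 * n * s) - 0 = 3 * n * s)%N by nia.
have -> : (minn M M - 3 * s = s)%N by lia.
by rewrite le_eqVlt; apply/orP; left; apply/eqP; rewrite !natrM; field.
Qed.

End grid_variance.

(** * Cells of the marked window and their measures *)

Section cells.
Context {R : realType} (d : nat) (a : nat -> R) (n : nat).
Hypothesis d_gt0 : (0 < d)%N.
Hypothesis a_gt0 : forall j : nat, (2 <= j <= d)%N -> 0 < a j.
Local Notation mu := (@lebesgue_measure R).
Local Notation T := (d.-tuple R * R)%type.
Local Notation D := (@window R d a n `*` `[(0 : R), 1]).

(* The (d-1)-dimensional volume of the sections of the window orthogonal to the first
   axis, hence the intensity of the pairs (location, lifetime). *)
Definition section_size : R := \prod_(k < d.-1) (a k.+2 * n%:R).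

Lemma section_size_ge0 : 0 <= section_size.
Proof.
apply: prodr_ge0 => k _; rewrite mulr_ge0// ltW// a_gt0//.
by have := ltn_ord k; lia.
Qed.

(* [a] is shifted by one because coordinates are numbered from 0. *)
Definition slab (m i : nat) (k : nat) : set R :=
  if k is 0 then `[0, n%:R] `&` `[i%:R / m%:R, i.+1%:R / m%:R[
  else `[0, a k.+1 * n%:R].

Definition life (m j : nat) : set R :=
  `[0, 1] `&` `[j%:R / m%:R, j.+1%:R / m%:R[.

Definition cell (m i j : nat) : set T := box (slab m i) d `*` life m j.

Lemma measurable_cell m i j : measurable (cell m i j).
Proof.
apply: measurableX; last exact: measurableI.
by apply: measurable_box => -[|k] //=; exact: measurableI.
Qed.

Lemma measurable_domain : measurable D.
Proof.
apply: measurableX => //.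
rewrite (_ : window a n = box (fun k =>
    [set x | 0 <= x <= (if k == 0%N then n%:R else a k.+1 * n%:R)]) d)//.
apply: measurable_box => k.
rewrite (_ : [set x | _] = `[0, (if k == 0%N then n%:R else a k.+1 * n%:R)]%classic)//.
Qed.

(** The half-open intervals make the cells, within the domain, the fibres of a pair of truncations.
    Disjointness of the cells and uniqueness of the cell of a point follow. *)
Lemma cellP m i j (z : T) : (0 < m)%N -> D z -> cell m i j z <->
  Num.truncn (m%:R * z.1`_0) = i /\ Num.truncn (m%:R * z.2) = j.
Proof.
move=> m_gt0 [Wz]; rewrite /= in_itv/= => z2.
have m0 : 0 < m%:R :> R by rewrite ltr0n.
have tE : tnth z.1 (Ordinal d_gt0) = z.1`_0 by rewrite (tnth_nth 0).
have := Wz (Ordinal d_gt0); rewrite tE /= => z1.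
have tr (x : R) k : 0 <= x -> (k%:R / m%:R <= x < k.+1%:R / m%:R) = (Num.truncn (m%:R * x) == k).
  move=> x0; rewrite truncn_eq ?mulr_ge0//.
  by rewrite ler_pdivrMr// ltr_pdivlMr// mulrC.
split=> [[/= cz []]|[e1 e2]].
  rewrite /= !in_itv/= => _ c2.
  have := cz (Ordinal d_gt0); rewrite tE /= => -[_]; rewrite /= in_itv/= => c1.
  by split; apply/eqP; rewrite -tr//; [case/andP: z1|case/andP: z2].
split; last by split; rewrite /= in_itv//= tr ?e2//; case/andP: z2.
move=> k /=; have := Wz k; rewrite (tnth_nth 0) /slab.
case: (nat_of_ord k) => [|l] /= kz; last by rewrite in_itv.
by split; rewrite /= in_itv//= tr ?e1//; case/andP: z1.
Qed.

Lemma cell_sub m i j : cell m i j `<=` D.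
Proof.
move=> [t l] [/= ct [cl _]]; split => // k.
have := ct k; rewrite /slab.
by case: (nat_of_ord k) => [|k'] /=; [move=> [+ _]|]; rewrite /= in_itv/= => ->.
Qed.

Let nu : set T -> \bar R := (lebesgue_tuple R d \x mu)%E.

Let mu_slab m i k : (0 < m)%N -> (k < d)%N -> (0 < k)%N ->
  mu (slab m i k) = (a k.+1 * n%:R)%:E.
Proof.
case: k => // k m0 kd _; rewrite /= lebesgue_measure_itv/= lte_fin.
have a0 : 0 < a k.+2 by rewrite a_gt0//; lia.
have [n0|n_gt0] := posnP n; first by rewrite n0 mulr0 ltxx.
by rewrite mulr_gt0// ?ltr0n// oppr0 adde0.
Qed.

Lemma measure_cell m i j : (0 < m)%N ->
  nu (cell m i j) = (mu (slab m i 0) * section_size%:E * mu (life m j))%E.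
Proof.
move=> m_gt0; rewrite /nu /cell.
have ms k : measurable (slab m i k) by case: k => [|k] //=; exact: measurableI.
have mbox : measurable (box (slab m i) d) by exact: measurable_box.
have mI : measurable (life m j) by exact: measurableI.
rewrite (product_measure1E (lebesgue_tuple R d) mu mbox mI); congr (_ * _)%E.
transitivity (\prod_(k < d) mu (slab m i k))%E; first exact: lebesgue_tuple_box.
move: d_gt0 mu_slab; rewrite /section_size.
case: d => // d' _ mu_slab'; rewrite big_ord_recl; congr (_ * _)%E.
rewrite -prodEFin; apply: eq_bigr => k _.
by apply: (mu_slab' m i k.+1) => //; have := ltn_ord k; lia.
Qed.

Lemma fine_measure_cell_ge0 m i j : 0 <= fine (nu (cell m i j)).
Proof. by rewrite fine_ge0. Qed.

Let lebesgue_itv_frac m i : (0 < m)%N ->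
  mu `[i%:R / m%:R, i.+1%:R / m%:R[ = (m%:R^-1)%:E.
Proof.
move=> m_gt0; rewrite lebesgue_measure_itv/= lte_fin ltr_pM2r ?invr_gt0 ?ltr0n//.
by rewrite ltr_nat ltnSn -EFinB -mulrBl -natr1 addrAC subrr add0r mul1r.
Qed.

Let frac_le (A : set R) m i : (0 < m)%N -> measurable A ->
  (mu (A `&` `[(i%:R / m%:R)%R, (i.+1%:R / m%:R)%R[) <= (m%:R^-1)%:E)%E.
Proof.
move=> m_gt0 mA; rewrite -(lebesgue_itv_frac i m_gt0).
by apply: le_measure; rewrite ?inE; [exact: measurableI| |exact: subIsetr].
Qed.

Lemma measure_cell_le m i j : (0 < m)%N ->
  fine (nu (cell m i j)) <= section_size / m%:R ^+ 2.
Proof.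
move=> m_gt0; have K0 := section_size_ge0.
have le_cell : (nu (cell m i j) <= (section_size / m%:R ^+ 2)%:E)%E.
  rewrite measure_cell// expr2 invfM mulrA [section_size * _]mulrC !EFinM.
  by rewrite lee_pmul ?mule_ge0// ?lee_fin ?frac_le// lee_wpmul2r ?lee_fin ?frac_le.
by rewrite -lee_fin fineK// ge0_fin_numE// (le_lt_trans le_cell)// ltry.
Qed.

Lemma measure_cell_eq m i j : (0 < m)%N -> (i < n * m)%N -> (j < m)%N ->
  fine (nu (cell m i j)) = section_size / m%:R ^+ 2.
Proof.
move=> m_gt0 inm jm; rewrite measure_cell//.
have m0 : 0 < m%:R :> R by rewrite ltr0n.
have sub (k N : nat) : (k < N * m)%N ->
    `[0, N%:R] `&` `[k%:R / m%:R, k.+1%:R / m%:R[ = `[k%:R / m%:R, k.+1%:R / m%:R[%classic :> set R.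
  move=> kN; apply/setIidr => x /=; rewrite !in_itv/= => /andP[kx xk].
  rewrite (le_trans _ kx) ?divr_ge0//= ltW// (lt_le_trans xk)//.
  by rewrite ler_pdivrMr// -natrM ler_nat.
rewrite /slab /life sub// -[1]/(1%:R) sub ?mul1n// !lebesgue_itv_frac// -!EFinM/=.
by field; rewrite gt_eqF.
Qed.

End cells.

(** * Pointwise convergence of the discretized relation *)

Section discretization.
Context {R : realType} (d : nat) (a : nat -> R) (n : nat).
Hypothesis d_gt0 : (0 < d)%N.
Local Notation T := (d.-tuple R * R)%type.
Local Notation D := (@window R d a n `*` `[(0 : R), 1]).
Local Notation cell := (cell a n).
Implicit Types z v : T.

Definition loc_index (m : nat) z : nat := Num.truncn (m%:R * z.1`_0).
Definition life_index (m : nat) z : nat := Num.truncn (m%:R * z.2).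

Lemma domain_bounds z : D z -> 0 <= z.1`_0 <= n%:R /\ 0 <= z.2 <= 1.
Proof.
move=> [Wz]; rewrite /= in_itv/= => z2; split => //.
by have := Wz (Ordinal d_gt0); rewrite (tnth_nth 0).
Qed.

Lemma inverted_sym z v : inverted z v -> inverted v z.
Proof.
rewrite /inverted => /and3P[h z01 v01]; apply/and3P; split => //.
by move: h; rewrite -mulrNN !opprD !opprK; congr (is_true (_ < 0)); ring.
Qed.

Let index_itv (m : nat) (x : R) : 0 <= x ->
  (Num.truncn (m%:R * x))%:R <= m%:R * x < (Num.truncn (m%:R * x)).+1%:R.
Proof. by move=> x0; rewrite truncn_itv ?mulr_ge0. Qed.

(** Rounding loses less than 1 per coordinate, which the 2 in [nests] covers: m (v_1 + l_v) < i' +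
    j' + 2 <= i + j <= m (z_1 + l_z). The lifetime of z is below 1 by its index, and that of v is
    shorter. *)
Lemma nests_inverted m z v : (0 < m)%N -> D z -> D v -> (life_index m z < m)%N ->
  nests (loc_index m z) (life_index m z) (loc_index m v) (life_index m v) ->
  inverted z v.
Proof.
move=> m_gt0 /domain_bounds[/andP[z1 _] /andP[z2 _]] /domain_bounds[/andP[v1 _] /andP[v2 _]].
have m0 : 0 < m%:R :> R by rewrite ltr0n.
rewrite /loc_index /life_index.
have /andP[z1l z1u] := index_itv m z1; have /andP[z2l z2u] := index_itv m z2.
have /andP[v1l v1u] := index_itv m v1; have /andP[v2l v2u] := index_itv m v2.
move: z1l z1u z2l z2u v1l v1u v2l v2u.
set i := Num.truncn _; set j := Num.truncn _.
set i' := Num.truncn _; set j' := Num.truncn _.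
move=> z1l z1u z2l z2u v1l v1u v2l v2u jm /and3P[ii' ij j'0].
have e1 : (i.+1%:R : R) <= i'%:R by rewrite ler_nat.
have e2 : (i'%:R + j'%:R + 2 : R) <= i%:R + j%:R by rewrite -!natrD ler_nat.
have e3 : 1 <= (j'%:R : R) by rewrite ler1n.
have e4 : (j.+1%:R : R) <= m%:R by rewrite ler_nat.
have zv1 : m%:R * z.1`_0 < m%:R * v.1`_0 by lra.
have zv2 : m%:R * (v.1`_0 + v.2) < m%:R * (z.1`_0 + z.2).
  by rewrite !mulrDr; move: z1u z2u v1u v2u e1 e2; rewrite -!natr1; lra.
have v2m : m%:R * 0 < m%:R * v.2 by rewrite mulr0; lra.
have z2m : m%:R * z.2 < m%:R * 1 by rewrite mulr1; lra.
rewrite !(ltr_pM2l m0) in zv1 zv2 v2m z2m.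
rewrite /inverted; apply/and3P; split; first by rewrite pmulr_llt0; lra.
  by apply/andP; split; lra.
by apply/andP; split; lra.
Qed.

(** The strict inequalities between births, between deaths and for the lifetime of v have positive
    gaps. Once m is at least 4 over each gap, each exceeds in mesh units the rounding losses and the
    margin 2 of [nests]. *)
Lemma inverted_nests z v : D z -> D v -> inverted z v -> z.1`_0 < v.1`_0 ->
  exists2 e : R, 0 < e & forall m : nat, e <= m%:R ->
  nests (loc_index m z) (life_index m z) (loc_index m v) (life_index m v).
Proof.
move=> /domain_bounds[/andP[z1 _] /andP[z2 _]] /domain_bounds[/andP[v1 _] /andP[v2 _]].
rewrite /inverted => /and3P[h /andP[z0 z3] /andP[v0 v3]] zv.
have dzv : 0 < z.1`_0 + z.2 - (v.1`_0 + v.2).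
  have : 0 < z.1`_0 - v.1`_0 + z.2 - v.2 by move: h; rewrite nmulr_rlt0 ?subr_lt0.
  lra.
have vz : 0 < v.1`_0 - z.1`_0 by rewrite subr_gt0.
exists (4 / (v.1`_0 - z.1`_0) + 4 / (z.1`_0 + z.2 - (v.1`_0 + v.2)) + 4 / v.2).
  by rewrite !addr_gt0// divr_gt0.
move=> m em.
have g1 : 0 < 4 / (v.1`_0 - z.1`_0) by rewrite divr_gt0.
have g2 : 0 < 4 / (z.1`_0 + z.2 - (v.1`_0 + v.2)) by rewrite divr_gt0.
have g3 : 0 < 4 / v.2 by rewrite divr_gt0.
have : 4 / (v.1`_0 - z.1`_0) <= m%:R by lra.
have : 4 / (z.1`_0 + z.2 - (v.1`_0 + v.2)) <= m%:R by lra.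
have : 4 / v.2 <= m%:R by lra.
rewrite !ler_pdivrMr// => h3 h2 h1.
rewrite /loc_index /life_index.
have /andP[z1l z1u] := index_itv m z1; have /andP[z2l z2u] := index_itv m z2.
have /andP[v1l v1u] := index_itv m v1; have /andP[v2l v2u] := index_itv m v2.
move: z1l z1u z2l z2u v1l v1u v2l v2u.
set i := Num.truncn _; set j := Num.truncn _.
set i' := Num.truncn _; set j' := Num.truncn _.
rewrite -!natr1 => z1l z1u z2l z2u v1l v1u v2l v2u.
rewrite mulrBr in h1; rewrite mulrBr !mulrDr in h2.
apply/and3P; split.
- by rewrite -(ltr_nat R); lra.
- by rewrite -(ler_nat R) !natrD; lra.
- by rewrite -(ltr_nat R); lra.
Qed.

(* Indicator that [z] and [v] lie in cells all of whose points are mutually inverted. *)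
Definition approx_inverted (m : nat) z v : R :=
  \sum_(p : 'I_(n * m).+1 * 'I_m) (z \in cell m p.1 p.2)%:R *
  \sum_(q : 'I_(n * m).+1 * 'I_m) @link R n m p q * (v \in cell m q.1 q.2)%:R.

Let loc_index_lt m z : D z -> (loc_index m z < (n * m).+1)%N.
Proof.
move=> /domain_bounds[/andP[z1 zn] _]; rewrite /loc_index truncn_lt_nat ?mulr_ge0//.
rewrite -natr1 natrM (@le_lt_trans _ _ (n%:R * m%:R))//; last by rewrite ltrDl.
by rewrite mulrC ler_wpM2r.
Qed.

(** A point lies in exactly one cell, unless its lifetime is 1: such a point has lifetime index m
    and lies in none. *)
Let sum_cell m z : (0 < m)%N -> D z ->
  (exists p : 'I_(n * m).+1 * 'I_m,
    [/\ p.1 = loc_index m z :> nat, p.2 = life_index m z :> nat &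
     forall F : 'I_(n * m).+1 * 'I_m -> R,
       \sum_(p : 'I_(n * m).+1 * 'I_m) (z \in cell m p.1 p.2)%:R * F p = F p]) \/
  ((m <= life_index m z)%N /\ forall F : 'I_(n * m).+1 * 'I_m -> R,
       \sum_(p : 'I_(n * m).+1 * 'I_m) (z \in cell m p.1 p.2)%:R * F p = 0).
Proof.
move=> m0 Dz.
have cE (p : 'I_(n * m).+1 * 'I_m) : (z \in cell m p.1 p.2) =
    (loc_index m z == p.1) && (life_index m z == p.2).
  apply/idP/andP => [/set_mem /(cellP d_gt0 _ _ m0 Dz)[/eqP ? /eqP ?] //|[/eqP ? /eqP ?]].
  by apply/mem_set/(cellP d_gt0 _ _ m0 Dz).
have [lm|ml] := ltnP (life_index m z) m; last first.
  right; split => // F; rewrite big1// => p _; rewrite cE.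
  by case: eqP => /= _; rewrite ?mul0r// gtn_eqF ?mul0r// (leq_trans (ltn_ord p.2)).
pose p0 := (Ordinal (loc_index_lt m Dz), Ordinal lm).
have cp0 : z \in cell m p0.1 p0.2 by rewrite cE /= !eqxx.
left; exists p0; split => // F.
transitivity (F p0 + 0); last exact: addr0.
rewrite (bigD1 p0)// cp0 mul1r; congr (_ + _); apply: big1 => p pp0.
rewrite cE (_ : _ && _ = false) ?mul0r//; apply: contraNF pp0 => /andP[/eqP e1 /eqP e2].
by case: p e1 e2 => i j /= e1 e2; apply/eqP; congr (_, _); exact: val_inj.
Qed.

Lemma approx_invertedE m z v : (0 < m)%N -> D z -> D v ->
  approx_inverted m z v = ((life_index m z < m)%N && (life_index m v < m)%N &&
    linked (loc_index m z) (life_index m z) (loc_index m v) (life_index m v))%:R.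
Proof.
move=> m0 Dz Dv; rewrite /approx_inverted.
have [[p [p1 p2 ->]]|[mz ->]] := sum_cell m0 Dz; last by rewrite ltnNge mz.
under eq_bigr do rewrite mulrC.
have [[q [q1 q2 ->]]|[mv ->]] := sum_cell m0 Dv; last by rewrite (ltnNge (life_index m v)) mv andbF.
by rewrite /link -p1 -p2 -q1 -q2 !ltn_ord.
Qed.

Lemma approx_inverted_ge0 m z v : 0 <= approx_inverted m z v.
Proof.
by apply: sumr_ge0 => p _; rewrite mulr_ge0// sumr_ge0// => q _; rewrite mulr_ge0.
Qed.

Lemma approx_inverted_le1 m z v : (0 < m)%N -> D z -> D v -> approx_inverted m z v <= 1.
Proof. by move=> m0 Dz Dv; rewrite approx_invertedE// lern1 leq_b1. Qed.

(** Linked cells contain only inverted pairs, so a pair that is not inverted is never counted. An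
    inverted pair has distinct first coordinates, and the earlier point nests the later one on all
    fine grids. *)
Lemma approx_inverted_near z v : D z -> D v ->
  \forall m \near \oo, approx_inverted m z v = (inverted z v)%:R.
Proof.
move=> Dz Dv; have [izv|izv] := boolP (inverted z v); last first.
  exists 1%N => // m /= m0; rewrite approx_invertedE//; apply/eqP.
  rewrite pnatr_eq0 eqb0; apply: contraNN izv => /andP[/andP[zm vm] /orP[]].
    exact: nests_inverted.
  by move=> h; apply: inverted_sym; exact: nests_inverted h.
have [e e0 eP] : exists2 e : R, 0 < e & forall m : nat, e <= m%:R ->
    linked (loc_index m z) (life_index m z) (loc_index m v) (life_index m v).
  have [zv|vz|zv] := ltgtP (z.1`_0) (v.1`_0).
  - have [e e0 eP] := inverted_nests Dz Dv izv zv.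
    by exists e => // m em; rewrite /linked eP.
  - have [e e0 eP] := inverted_nests Dv Dz (inverted_sym izv) vz.
    by exists e => // m em; rewrite /linked eP// orbT.
  - by move: izv; rewrite /inverted zv subrr mul0r ltxx.
exists (maxn 1 (Num.truncn e).+1) => // m /=; rewrite geq_max => /andP[m0 em].
have em' : e <= m%:R.
  by rewrite ltW// (lt_le_trans (truncnS_gt e))// ler_nat.
(* Inverted points have lifetimes strictly below 1, hence lifetime indices below m. *)
rewrite approx_invertedE// eP// andbT.
have /and3P[_ /andP[_ z1] /andP[_ v1]] := izv.
have [_ /andP[z2 _]] := domain_bounds Dz; have [_ /andP[v2 _]] := domain_bounds Dv.
have m0' : 0 < m%:R :> R by rewrite ltr0n.
by rewrite /life_index !truncn_lt_nat ?mulr_ge0// -!ltr_pdivlMl// mulVf ?gt_eqF// z1 v1.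
Qed.

End discretization.

(** * Normal approximation of the inversion count *)

Section process_counts.
Context disp (Omega : measurableType disp) (R : realType) (P : probability Omega R).
Context d1 (T : measurableType d1) (D : set T) (mu : set T -> \bar R)
  (X : Omega -> {fset T}).
Hypothesis Xp : poisson_process P D mu X.
Hypothesis mu_ge0 : forall A, (0 <= mu A)%E.

Lemma npoints_sum (A : set T) w :
  (npoints X A w)%:R = \sum_(z <- X w) (z \in A)%:R :> R.
Proof.
rewrite /npoints card_fset_sum1 natr_sum -big_fset_condE/= [LHS]big_mkcond/=.
by apply: eq_bigr => z _; case: (z \in A).
Qed.

Lemma npoints_domain w : npoints X D w = #|` X w|.
Proof.
congr (#|` _|); apply/fsetP => z; rewrite !inE/= andb_idr// => zX.
by apply/mem_set; exact: (pp_in Xp) zX.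
Qed.

Lemma measurable_npoints1 (A : set T) k : measurable A -> A `<=` D ->
  measurable (npoints X A @^-1` [set k]).
Proof.
move=> mA AD; rewrite -[X in measurable X]setTI.
exact: (pp_measurable Xp mA AD).
Qed.

Lemma npoints_rec (A : set T) k : measurable A -> A `<=` D ->
  (k.+1%:R%:E * P (npoints X A @^-1` [set k.+1]) =
   (fine (mu A))%:E * P (npoints X A @^-1` [set k]))%E.
Proof.
move=> mA AD; rewrite !(pp_poisson Xp mA AD) /poisson_prob.
(* At rate 0 the law is the Dirac mass at 0 and both sides vanish. *)
case: ifPn => [l0|]; last first.
  rewrite -leNgt => l0; have -> : fine (mu A) = 0.
    by apply/eqP; rewrite eq_le l0 fine_ge0.
  by rewrite mul0e diracE memNset ?mule0.
rewrite !esum_set1 ?lee_fin ?poisson_pmf_ge0// -!EFinM /poisson_pmf l0.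
congr EFin; rewrite factS natrM exprS; field.
by rewrite -mulrS !pnatr_eq0 -lt0n fact_gt0.
Qed.

Lemma npoints_indep (J : finType) (A : J -> set T) :
  (forall i, measurable (A i)) -> (forall i, A i `<=` D) -> trivIset setT A ->
  forall nu : J -> nat,
  P (\bigcap_(i in [set: J]) (npoints X (A i) @^-1` [set nu i])) =
  (\prod_i P (npoints X (A i) @^-1` [set nu i]))%E.
Proof.
move=> mA AD tA nu.
have tA' : trivIset setT (fun k : 'I_#|J| => A (enum_val k)).
  by move=> k l _ _ /(tA _ _ I I)/enum_val_inj.
have := pp_independent Xp (fun k => mA (enum_val k)) (fun k => AD (enum_val k)) tA'
  (fun k => [set nu (enum_val k)]).
rewrite (_ : \bigcap_i _ = \bigcap_(i in [set: J]) (npoints X (A i) @^-1` [set nu i])); last first.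
  apply/seteqP; split => w h i _; last exact: h.
  by have := h (enum_rank i) I; rewrite enum_rankK.
move=> ->; rewrite -(big_enum_val (fun i => P (npoints X (A i) @^-1` [set nu i])))/=.
exact: eq_bigl.
Qed.

End process_counts.

Lemma cvg_Rintegral_dominated disp (Omega : measurableType disp) (R : realType)
    (P : probability Omega R) (f_ : nat -> Omega -> R) (f g : Omega -> R) :
  (forall k, measurable_fun [set: Omega] (f_ k)) -> measurable_fun [set: Omega] f ->
  (forall w, f_ ^~ w @ \oo --> f w) ->
  P.-integrable setT (EFin \o g) -> (forall k w, `|f_ k w| <= g w) ->
  P.-integrable setT (EFin \o f) /\
  (\int[P]_w f_ k w)%R @[k --> \oo] --> (\int[P]_w f w)%R.
Proof.
move=> mf_ mf cf ig fg.
have [||||| i1 _ c1] := @dominated_convergence _ _ _ P setT measurableT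
  (fun k w => (f_ k w)%:E) (EFin \o f) (EFin \o g).
- by move=> k; apply/measurable_EFinP; exact: mf_.
- exact/measurable_EFinP.
- by apply: aeW => w _; apply/fine_cvgP; split; [exact: nearW|exact: cf].
- exact: ig.
- by apply: aeW => w k _; rewrite lee_fin.
by split => //; apply: fine_cvg; rewrite fineK//; exact: integrable_fin_num.
Qed.

(** * Passage from the discretized counts to the inversion count *)

Section inversion_process.
Context disp (Omega : measurableType disp) (R : realType) (P : probability Omega R).
Context (d : nat) (a : nat -> R) (n : nat).
Hypothesis d_gt0 : (0 < d)%N.
Hypothesis a_gt0 : forall j : nat, (2 <= j <= d)%N -> 0 < a j.
Hypothesis n_gt0 : (0 < n)%N.
Local Notation T := (d.-tuple R * R)%type.
Local Notation D := (@window R d a n `*` `[(0 : R), 1]).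
Local Notation mu := (lebesgue_tuple R d \x lebesgue_measure)%E.
Variable X : Omega -> {fset T}.
Hypothesis Xp : poisson_process P D mu X.

Let mu_ge0 A : (0 <= mu A)%E. Proof. by []. Qed.

Definition inversion_count w : R := inversions (X w).
Definition approx_count (m : nat) w : R :=
  \sum_(z <- X w) \sum_(v <- X w) approx_inverted a n m z v.

Let K := section_size d a n.
Let lam (m : nat) (p : 'I_(n * m).+1 * 'I_m) : R := fine (mu (cell a n m p.1 p.2)).
Let N (m : nat) (p : 'I_(n * m).+1 * 'I_m) : Omega -> nat :=
  npoints X (cell a n m p.1 p.2).

Let lam_ge0 m p : 0 <= @lam m p. Proof. exact: fine_measure_cell_ge0. Qed.

Let mN m p k : measurable (@N m p @^-1` [set k]).
Proof. by apply: (measurable_npoints1 Xp); [exact: measurable_cell|exact: cell_sub]. Qed.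

Let N_rec m p k : (k.+1%:R%:E * P (@N m p @^-1` [set k.+1]) =
  (lam p)%:E * P (N p @^-1` [set k]))%E.
Proof. by apply: (npoints_rec Xp mu_ge0); [exact: measurable_cell|exact: cell_sub]. Qed.

Let N_indep m : (0 < m)%N -> forall nu : _ -> nat,
  P (\bigcap_(i in [set: 'I_(n * m).+1 * 'I_m]) (@N m i @^-1` [set nu i])) =
  (\prod_i P (@N m i @^-1` [set nu i]))%E.
Proof.
move=> m0; apply: (npoints_indep Xp).
- by move=> p; exact: measurable_cell.
- by move=> p; exact: cell_sub.
- move=> [i j] [i' j'] _ _ [z [/= cz cz']].
  have Dz := cell_sub cz.
  have [e1 e2] := (cellP d_gt0 _ _ m0 Dz).1 cz.
  have [e3 e4] := (cellP d_gt0 _ _ m0 Dz).1 cz'.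
  by congr (_, _); apply: val_inj; rewrite /= -?e1 -?e2.
Qed.

(** Grouping the points by cell turns the sum over pairs of points into a quadratic form in the cell
    counts. *)
Lemma approx_countE m w :
  approx_count m w = edge_count (@link R n m) (pvec (@N m) w).
Proof.
rewrite /edge_count /approx_count /approx_inverted.
under eq_bigr do rewrite exchange_big/=.
rewrite exchange_big/=; apply: eq_bigr => p _.
rewrite ffunE /N npoints_sum mulr_suml; apply: eq_bigr => z _.
rewrite -mulr_sumr; congr (_ * _); rewrite exchange_big/= /linf.
by apply: eq_bigr => q _; rewrite -mulr_sumr ffunE npoints_sum.
Qed.

Lemma approx_count_cvg w :
  approx_count (4 * k.+2) w @[k --> \oo] --> inversion_count w.
Proof.
have inX (F : T -> R) : \sum_(z <- X w) F z = \sum_(z <- X w | z \in X w) F z.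
  by rewrite big_seq.
rewrite /inversion_count /inversions inX.
under eq_bigr do rewrite inX.
rewrite (_ : (fun k => _) = fun k : nat => \sum_(z <- X w | z \in X w)
    \sum_(v <- X w | v \in X w) approx_inverted a n (4 * k.+2) z v); last first.
  by apply/funext => k; rewrite /approx_count inX; apply: eq_bigr => z _; rewrite inX.
apply: cvg_big => [|z zX]; first exact: add_continuous.
apply: cvg_big => [|v vX]; first exact: add_continuous.
apply: cvg_near_cst.
have [m0 _ m0P] := approx_inverted_near d_gt0 (pp_in Xp zX) (pp_in Xp vX).
by exists m0 => // k /= mk; apply: m0P => /=; lia.
Qed.

Let npts_card w : (npoints X D w)%:R = \sum_(z <- X w) 1 :> R.
Proof. by rewrite (npoints_domain Xp) card_fset_sum1 natr_sum. Qed.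

Lemma approx_count_ge0 m w : 0 <= approx_count m w.
Proof.
by apply: sumr_ge0 => z _; apply: sumr_ge0 => v _; exact: approx_inverted_ge0.
Qed.

Lemma approx_count_le m w : (0 < m)%N ->
  approx_count m w <= (npoints X D w)%:R ^+ 2.
Proof.
move=> m0; rewrite expr2 npts_card mulr_suml /approx_count big_seq [leRHS]big_seq.
apply: ler_sum => z zX; rewrite mul1r big_seq [leRHS]big_seq.
apply: ler_sum => v vX; apply: (approx_inverted_le1 d_gt0 m0).
  exact: (pp_in Xp zX).
exact: (pp_in Xp vX).
Qed.

Lemma integrable_npoints_domain p :
  P.-integrable setT (fun w => ((npoints X D w)%:R ^+ p)%:E).
Proof.
(* The total number of points is treated as a Poisson vector with a single coordinate. *)
pose N1 (i : unit) := npoints X D.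
have mD : measurable D by exact: measurable_domain.
have DD : D `<=` D by [].
have h := @integrable_pb _ Omega R P unit N1 (fun=> fine (mu D)).
have := h _ _ _ _ (fun nu => (nu tt)%:R ^+ p).
rewrite (_ : EFin \o _ = (fun w => ((npoints X D w)%:R ^+ p)%:E)); last first.
  by apply/funext => w /=; rewrite ffunE.
apply.
- by move=> _; exact: fine_ge0.
- by move=> i k; exact: (measurable_npoints1 Xp k mD DD).
- by move=> i k; exact: (npoints_rec Xp mu_ge0 k mD DD).
- apply: (npoints_indep Xp (A := fun=> D)) => //.
  by move=> [] [].
- by apply: pbX; exact: pb_coord.
Qed.

Lemma measurable_approx_count m : measurable_fun [set: Omega] (approx_count m).
Proof.
rewrite (_ : approx_count m = edge_count (@link R n m) \o pvec (@N m)).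
  by apply: measurable_fun_pvec; exact: mN.
by apply/funext => w; rewrite approx_countE.
Qed.

Lemma measurable_inversion_count : measurable_fun [set: Omega] inversion_count.
Proof.
apply: (@measurable_fun_cvg _ _ _ setT (fun k => approx_count (4 * k.+2))).
  by move=> k; exact: measurable_approx_count.
by move=> w _; exact: approx_count_cvg.
Qed.

(* The mesh is a multiple of 4 in order that [edge_var_link_ge] applies. *)
Let count_approx (k : nat) : Omega -> R := approx_count (4 * k.+2).
Let npD w : R := (npoints X D w)%:R.

Let count_approx_le k w : count_approx k w <= npD w ^+ 2.
Proof. exact: approx_count_le. Qed.

Let count_approx_ge0 k w : 0 <= count_approx k w.
Proof. exact: approx_count_ge0. Qed.

Let inpD p : P.-integrable setT (EFin \o (fun w => npD w ^+ p)).
Proof. exact: integrable_npoints_domain. Qed.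

Definition count_mean : R := (\int[P]_w inversion_count w)%R.
Definition count_var : R := (\int[P]_w ((inversion_count w - count_mean) ^+ 2))%R.
Let mean_approx k : R := (\int[P]_w count_approx k w)%R.

Lemma count_mean_cvg : P.-integrable setT (EFin \o inversion_count) /\
  mean_approx k @[k --> \oo] --> count_mean.
Proof.
apply: (cvg_Rintegral_dominated (g := fun w => npD w ^+ 2)) => //.
- by move=> k; exact: measurable_approx_count.
- exact: measurable_inversion_count.
- exact: approx_count_cvg.
- by move=> k w; rewrite ger0_norm.
Qed.

Let integrable_count_approx k : P.-integrable setT (EFin \o count_approx k).
Proof.
apply: (@le_integrable _ _ _ P _ measurableT _ (EFin \o (fun w => npD w ^+ 2))) => //.
- by apply/measurable_EFinP; exact: measurable_approx_count.
- move=> w _; rewrite !abse_EFin lee_fin ger0_norm// (le_trans (count_approx_le _ _))//.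
  exact: ler_norm.
Qed.

Let mean_approx_bound k : 0 <= mean_approx k <= (\int[P]_w (npD w ^+ 2))%R.
Proof.
apply/andP; split; first exact: Rintegral_ge0.
exact: le_Rintegral.
Qed.

(** Quadratic growth covers both uses: the square, for the variance, and the rescaled Lipschitz test
    functions. *)
Lemma centered_cvg (F : R -> R) (A B : R) : continuous F -> 0 <= B ->
  (forall y, `|F y| <= A + B * y ^+ 2) ->
  P.-integrable setT (EFin \o (fun w => F (inversion_count w - count_mean))) /\
  (\int[P]_w F (count_approx k w - mean_approx k))%R @[k --> \oo] -->
  (\int[P]_w F (inversion_count w - count_mean))%R.
Proof.
move=> cF B0 FAB.
(* The counts lie between 0 and npD^2 and their means between 0 and c, so the centered counts are at
   most npD^2 + c in size; the square of this is integrable, npD having all moments. *)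
pose c := (\int[P]_w (npD w ^+ 2))%R.
have mF : measurable_fun [set: R] F by exact: continuous_measurable_fun.
apply: (cvg_Rintegral_dominated (g := fun w => A + B * (npD w ^+ 2 + c) ^+ 2)).
- move=> k; apply: (measurableT_comp mF); apply: measurable_funB => //.
  exact: measurable_approx_count.
- apply: (measurableT_comp mF); apply: measurable_funB => //.
  exact: measurable_inversion_count.
- move=> w; apply: (cvg_comp (fun k => count_approx k w - mean_approx k) F); last exact: cF.
  by apply: cvgB; [exact: approx_count_cvg|exact: count_mean_cvg.2].
- rewrite (_ : EFin \o _ = (fun w => (A + B * c ^+ 2)%:E +
     ((B%:E * (npD w ^+ 4)%:E) + (2 * B * c)%:E * (npD w ^+ 2)%:E))%E); last first.
    by apply/funext => w /=; rewrite -!EFinM -!EFinD; congr EFin; ring.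
  apply: integrableD => //; first exact: finite_measure_integrable_cst.
  by apply: integrableD => //; apply: integrableZl => //; exact: inpD.
- move=> k w; rewrite (le_trans (FAB _))// lerD2l ler_wpM2l//.
  have := mean_approx_bound k; rewrite -/c => /andP[m0 mc].
  have := count_approx_ge0 k w; have := count_approx_le k w => h1 h2.
  rewrite -(real_normK (num_real (_ - _))) lerXn2r ?nnegrE//.
    by rewrite addr_ge0 ?exprn_ge0// (le_trans m0).
  by rewrite ler_norml; apply/andP; split; lra.
Qed.

Lemma count_var_cvg :
  (\int[P]_w ((count_approx k w - mean_approx k) ^+ 2))%R @[k --> \oo] --> count_var.
Proof.
apply: (@centered_cvg (fun y => y ^+ 2) 0 1 _ _ _).2 => //.
  by move=> y; apply: exprn_continuous.
by move=> y; rewrite add0r mul1r ger0_norm ?sqr_ge0.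
Qed.

Let ExE k (G : {ffun 'I_(n * (4 * k.+2)).+1 * 'I_(4 * k.+2) -> nat} -> R) :
  Ex P (@N (4 * k.+2)) G = (\int[P]_w G (pvec (@N (4 * k.+2)) w))%R.
Proof. by []. Qed.

Let m_gt0 k : (0 < 4 * k.+2)%N. Proof. by []. Qed.

Let mean_approxE k :
  mean_approx k = edge_mean (@lam (4 * k.+2)) (@link R n (4 * k.+2)).
Proof.
rewrite -(@Ex_edge_count _ Omega R P _ (@N (4 * k.+2)) (@lam (4 * k.+2)))//.
- by apply: eq_Rintegral => w _; rewrite /count_approx approx_countE.
- exact: N_indep.
- exact: linkC.
- exact: link_diag.
Qed.

Let var_approxE k :
  (\int[P]_w ((count_approx k w - mean_approx k) ^+ 2))%R =
  edge_var (@lam (4 * k.+2)) (@link R n (4 * k.+2)).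
Proof.
rewrite -(@Ex_edge_count_variance _ Omega R P _ (@N (4 * k.+2)) (@lam (4 * k.+2)))//.
- apply: eq_Rintegral => w _.
  by rewrite mean_approxE /count_approx approx_countE.
- exact: N_indep.
- exact: linkC.
- exact: link_idem.
- exact: link_diag.
Qed.

Let K_ge0 : 0 <= K. Proof. exact: section_size_ge0. Qed.

Let lam_le m (p : 'I_(n * m).+1 * 'I_m) : (0 < m)%N -> @lam m p <= K / m%:R ^+ 2.
Proof. by move=> m0; exact: measure_cell_le. Qed.

Let lam_eq m (p : 'I_(n * m).+1 * 'I_m) : (0 < m)%N -> (p.1 < n * m)%N -> @lam m p = K / m%:R ^+ 2.
Proof. by move=> m0 pm; exact: measure_cell_eq. Qed.

Lemma count_var_ge : 3 / 1024 * (n%:R * K ^+ 3) <= count_var.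
Proof.
apply: (ler_cvg_to (cvg_cst _) count_var_cvg).
apply: nearW => k; rewrite var_approxE.
by apply: edge_var_link_ge => // p; exact: lam_eq.
Qed.

(** The bound for edge counts is applied on each grid with the limiting scale s; the variance
    mismatch tends to 0 and the remaining terms do not depend on the grid. *)
Lemma count_normal_approx (x C : R) (h phi dphi : R -> R) :
  0 < x -> n%:R * K <= x ^+ 2 -> 0 < count_var ->
  1.-lipschitz h ->
  (forall y : R, is_derive y 1 phi (dphi y)) ->
  (forall y : R, dphi y - y * phi y = h y - normal_mean h) ->
  (forall y : R, `|phi y| <= C) -> (forall y : R, `|dphi y| <= C) ->
  (forall y z : R, `|dphi y - dphi z| <= C * `|y - z|) ->
  P.-integrable setT (EFin \o (fun w => h ((inversion_count w - count_mean) / Num.sqrt count_var))) /\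
  `|(\int[P]_w h ((inversion_count w - count_mean) / Num.sqrt count_var))%R - normal_mean h| <=
  C * (37 * (2 * x) * (2 * K + 1) ^+ 2) / Num.sqrt count_var ^+ 2 +
  28 * C * (2 * x) ^+ 2 * (2 * K + 1) ^+ 3 / Num.sqrt count_var ^+ 3.
Proof.
move=> x0 nKx V0 hlip dp steinE phiC dphiC dlip; set s := Num.sqrt count_var.
have s0 : 0 < s by rewrite sqrtr_gt0.
have s2 : s ^+ 2 = count_var by rewrite sqr_sqrtr// ltW.
have C0 : 0 <= C by exact: le_trans (phiC 0).
pose F y := h (y / s).
have [iF cF] : P.-integrable setT (EFin \o (fun w => F (inversion_count w - count_mean))) /\
  (\int[P]_w F (count_approx k w - mean_approx k))%R @[k --> \oo] -->
  (\int[P]_w F (inversion_count w - count_mean))%R.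
  (* |h (y / s)| <= |h 0| + |y| / s, and |y| <= 1 + y^2. *)
  apply: (@centered_cvg F (`|h 0| + s^-1) s^-1); last 2 first.
  - by rewrite invr_ge0 ltW.
  - move=> y; have /klipschitz1P/(_ (y / s) 0) := hlip.
    rewrite subr0 normrM normfV (gtr0_norm s0) => hy.
    rewrite /F -(subrK (h 0) (h (y / s))) (le_trans (ler_normD _ _))//.
    rewrite addrC -addrA lerD2l (le_trans hy)//.
    rewrite -[X in _ <= X + _]mulr1 -mulrDr mulrC ler_wpM2l ?invr_ge0 ?(ltW s0)//.
    by have := sqr_ge0 (`|y| - 1); rewrite -(real_normK (num_real y)); nra.
  - move=> y; apply: (@cvg_comp _ _ _ (fun z => z / s) h _ (nbhs (y / s)));
      last exact: (klipschitz1_continuous hlip).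
    by apply: cvgM; [exact: cvg_id|exact: cvg_cst].
split; first exact: iF.
have bound k :
  `|(\int[P]_w F (count_approx k w - mean_approx k))%R - normal_mean h| <=
  C * (`|s ^+ 2 - (\int[P]_w ((count_approx k w - mean_approx k) ^+ 2))%R|
       + 37 * (2 * x) * (2 * K + 1) ^+ 2) / s ^+ 2 +
  28 * C * (2 * x) ^+ 2 * (2 * K + 1) ^+ 3 / s ^+ 3.
  (* The neighbourhood bound 2 K is raised to 2 K + 1 to be at least 1; r = 2 x works since the
     total intensity is at most 2 n K <= (2 x)^2. *)
  have := @edge_count_normal_approx _ Omega R P _ (@N (4 * k.+2)) (@lam (4 * k.+2))
     _ _ _ _ (@link R n (4 * k.+2)) _ _ _ (2 * K + 1) (2 * x) _ _ _ _
     h phi dphi C s s0 dp steinE phiC dphiC dlip.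
  rewrite var_approxE -mean_approxE ExE.
  rewrite (_ : (\int[P]_w _)%R = (\int[P]_w F (count_approx k w - mean_approx k))%R); last first.
    by apply: eq_Rintegral => w _; rewrite /F /count_approx approx_countE.
  apply.
  - by move=> *; exact: lam_ge0.
  - by move=> *; exact: mN.
  - by move=> *; exact: N_rec.
  - by move=> *; exact: N_indep.
  - exact: linkC.
  - exact: link_idem.
  - exact: link_diag.
  - by rewrite lerDr mulr_ge0.
  - move=> p; apply: (@le_trans _ _ (2 * K)); last by rewrite lerDl.
    apply: meanf_link_le => //.
    by move=> q; exact: lam_le.
  - by rewrite mulr_gt0.
  - apply: (@le_trans _ _ (2 * (n%:R * K))).
      apply: sum_lam_le => //; by move=> q; exact: lam_le.
    have := K_ge0; have : 0 <= n%:R :> R by []; nra.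
pose V k : R := (\int[P]_w ((count_approx k w - mean_approx k) ^+ 2))%R.
have cvgL : `|(\int[P]_w F (count_approx k w - mean_approx k))%R - normal_mean h|
    @[k --> \oo] --> `|(\int[P]_w F (inversion_count w - count_mean))%R - normal_mean h|.
  by apply: cvg_norm; apply: cvgB; [exact: cF|exact: cvg_cst].
have cvgV : `|s ^+ 2 - V k| @[k --> \oo] --> (0 : R).
  rewrite -(normr0 R) -(subrr (s ^+ 2)); apply: cvg_norm; apply: cvgB; first exact: cvg_cst.
  by rewrite s2; exact: count_var_cvg.
have cvgR : C * (`|s ^+ 2 - V k| + 37 * (2 * x) * (2 * K + 1) ^+ 2) / s ^+ 2 +
  28 * C * (2 * x) ^+ 2 * (2 * K + 1) ^+ 3 / s ^+ 3 @[k --> \oo] -->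
  C * (0 + 37 * (2 * x) * (2 * K + 1) ^+ 2) / s ^+ 2 +
  28 * C * (2 * x) ^+ 2 * (2 * K + 1) ^+ 3 / s ^+ 3.
  apply: cvgD; last exact: cvg_cst.
  apply: cvgM; last exact: cvg_cst.
  apply: cvgM; first exact: cvg_cst.
  by apply: cvgD; [exact: cvgV|exact: cvg_cst].
rewrite add0r in cvgR.
exact: (ler_cvg_to cvgL cvgR (nearW _ bound)).
Qed.

Lemma wasserstein_count (x C : R) : 0 < x -> n%:R * K <= x ^+ 2 -> 0 < count_var ->
  (forall h : R -> R, 1.-lipschitz h -> exists phi dphi : R -> R,
  [/\ forall y : R, is_derive y 1 phi (dphi y),
      forall y, dphi y - y * phi y = h y - normal_mean h,
      forall y, `|phi y| <= C, forall y, `|dphi y| <= C &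
      forall y z, `|dphi y - dphi z| <= C * `|y - z|]) ->
  (wasserstein P (standardize P inversion_count) (normal_prob 0 1) idfun <=
  (C * (37 * (2 * x) * (2 * K + 1) ^+ 2) / Num.sqrt count_var ^+ 2 +
   28 * C * (2 * x) ^+ 2 * (2 * K + 1) ^+ 3 / Num.sqrt count_var ^+ 3)%:E)%E.
Proof.
move=> x0 nKx V0 stein; apply: ge_ereal_sup => _ [h /= hlip <-].
have [phi [dphi [dp steinE phiC dphiC dlip]]] := stein h hlip.
have [ih le] := count_normal_approx x0 nKx V0 hlip dp steinE phiC dphiC dlip.
have Eh : ('E_P[h \o standardize P inversion_count] =
    (\int[P]_w h ((inversion_count w - count_mean) / Num.sqrt count_var))%R%:E)%E.
  rewrite /standardize (_ : fine 'E_P[inversion_count] = count_mean); last by rewrite unlock.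
  rewrite (_ : fine 'V_P[inversion_count] = count_var); last first.
    rewrite /variance covariance.unlock !expectation.unlock.
    exact: erefl.
  by rewrite unlock [RHS]fineK//; exact: (integrable_fin_num _ ih).
by rewrite Eh expectation_normal_prob// -EFinB abse_EFin lee_fin.
Qed.

End inversion_process.

(** Substituting 2 K + 1 <= beta K and s >= x K / 32 cancels all powers of K and leaves 1 / x in
    both terms; 74 = 37 * 2 and 112 = 28 * 2^2. *)
Lemma rate_le (R : realType) (x K C beta s : R) :
  0 < x -> 0 < K -> 0 <= C -> 2 * K + 1 <= beta * K -> x * K / 32 <= s ->
  C * (37 * (2 * x) * (2 * K + 1) ^+ 2) / s ^+ 2 +
  28 * C * (2 * x) ^+ 2 * (2 * K + 1) ^+ 3 / s ^+ 3 <=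
  C * (74 * (32 * beta) ^+ 2 + 112 * (32 * beta) ^+ 3) / x.
Proof.
move=> x0 K0 C0 Kb ys.
have y0 : 0 < x * K / 32 by rewrite divr_gt0// mulr_gt0.
have s0 : 0 < s by exact: lt_le_trans ys.
have K1 : 0 <= 2 * K + 1 by rewrite addr_ge0// mulr_ge0// ltW.
have pow p : (2 * K + 1) ^+ p <= (beta * K) ^+ p.
  by rewrite lerXn2r// nnegrE// (le_trans K1).
have inv p : (s ^+ p)^-1 <= ((x * K / 32) ^+ p)^-1.
  by rewrite lef_pV2 ?posrE ?exprn_gt0// lerXn2r// nnegrE ltW.
have -> : C * (74 * (32 * beta) ^+ 2 + 112 * (32 * beta) ^+ 3) / x =
  C * (37 * (2 * x) * (beta * K) ^+ 2) / (x * K / 32) ^+ 2 +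
  28 * C * (2 * x) ^+ 2 * (beta * K) ^+ 3 / (x * K / 32) ^+ 3.
  by field; rewrite !gt_eqF.
have x0' := ltW x0.
have sinv p : 0 <= (s ^+ p)^-1 by rewrite invr_ge0 exprn_ge0// ltW.
apply: lerD; apply: ler_pM => //.
- by rewrite !mulr_ge0 ?exprn_ge0.
- by rewrite ler_wpM2l// ler_wpM2l ?mulr_ge0.
- by rewrite !mulr_ge0 ?exprn_ge0 ?mulr_ge0.
- by rewrite ler_wpM2l// !mulr_ge0 ?exprn_ge0 ?mulr_ge0.
Qed.

Theorem mainTheorem6 (R : realType) (d : nat) (a : nat -> R)
    (disp : nat -> measure_display)
    (Omega : forall n : nat, measurableType (disp n))
    (P : forall n : nat, probability (Omega n) R)
    (X : forall n : nat, Omega n -> {fset (d.-tuple R * R)})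
    (d_gt0 : (0 < d)%N)
    (a_gt0 : forall j : nat, (2 <= j <= d)%N -> 0 < a j)
    (X_poisson : forall n : nat,
      poisson_process (P n) (@window R d a n `*` `[(0 : R), 1])
        (lebesgue_tuple R d \x lebesgue_measure)%E (X n))
    (delta : R) (delta_gt0 : 0 < delta) :
  \forall n \near \oo,
    (wasserstein (P n) (standardize (P n) (fun w => inversions (X n w)))
                 (normal_prob 0 1) idfun
      <= (n%:R `^ (- (d%:R / 2) + delta))%:E)%E.
Proof.
have [C C0 stein] := @stein_equation R.
pose c : R := \prod_(k < d.-1) a k.+2.
have c0 : 0 < c.
  by apply: prodr_gt0 => k _; apply: a_gt0; have := ltn_ord k; lia.
(* K = c n^(d-1) >= c, so that 2 K + 1 <= (2 + 1 / c) K. *)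
pose beta : R := 2 + c^-1.
pose C1 := C * (74 * (32 * beta) ^+ 2 + 112 * (32 * beta) ^+ 3) / Num.sqrt c.
have beta0 : 0 < beta by rewrite addr_gt0// invr_gt0.
have C10 : 0 < C1.
  by rewrite divr_gt0 ?sqrtr_gt0// mulr_gt0// addr_gt0// mulr_gt0// exprn_gt0// mulr_gt0.
(* Beyond this threshold C1 <= n^delta. *)
exists (maxn 1 (Num.truncn (C1 `^ delta^-1)).+1) => // n /=.
rewrite geq_max => /andP[n_gt0 nC1].
have n0 : 0 < n%:R :> R by rewrite ltr0n.
have n1 : 1 <= n%:R :> R by rewrite ler1n.
have KE : section_size d a n = c * n%:R ^+ d.-1.
  by rewrite /section_size big_split/= prodr_const card_ord.
have K0 : 0 < section_size d a n by rewrite KE mulr_gt0// exprn_gt0.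
(* Chosen so that x^2 = n K; then 1 / x is of order n^(-d/2). *)
pose x := Num.sqrt (c * n%:R ^+ d).
have x0 : 0 < x by rewrite sqrtr_gt0 mulr_gt0// exprn_gt0.
have x2 : x ^+ 2 = n%:R * section_size d a n.
  rewrite sqr_sqrtr ?mulr_ge0 ?exprn_ge0 ?ltW// KE mulrCA -exprS prednK//.
have V_ge := count_var_ge d_gt0 a_gt0 n_gt0 (X_poisson n).
(* The constant 32 comes from 3 / 1024 >= 1 / 32^2. *)
have V_ge' : (x * section_size d a n / 32) ^+ 2 <= count_var (P n) (X n).
  apply: le_trans V_ge; rewrite !exprMn x2.
  have : 0 <= n%:R * section_size d a n ^+ 3 by rewrite mulr_ge0// exprn_ge0// ltW.
  have -> : n%:R * section_size d a n * section_size d a n ^+ 2 * 32^-1 ^+ 2 =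
     1 / 1024 * (n%:R * section_size d a n ^+ 3) by field.
  lra.
have y0 : 0 < x * section_size d a n / 32 by rewrite divr_gt0// mulr_gt0.
have V0 : 0 < count_var (P n) (X n) by rewrite (lt_le_trans _ V_ge')// exprn_gt0.
apply: (le_trans (wasserstein_count d_gt0 a_gt0 n_gt0 (X_poisson n) x0 _ V0 stein)).
  by rewrite x2.
rewrite lee_fin; apply: (le_trans (rate_le (beta := beta) x0 K0 (ltW C0) _ _)).
- rewrite /beta [leRHS]mulrDl lerD2l KE mulrA mulVf ?gt_eqF// mul1r.
  exact: exprn_ege1.
- by rewrite -(ler_pXn2r (n := 2))// ?nnegrE ?sqrtr_ge0 ?(ltW y0)// sqr_sqrtr// ltW.
have -> : C * (74 * (32 * beta) ^+ 2 + 112 * (32 * beta) ^+ 3) / x =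
    C1 * n%:R `^ (- (d%:R / 2)).
  rewrite powRN powRrM powR_mulrn// powR12_sqrt ?exprn_ge0// /x sqrtrM ?(ltW c0)//.
  by rewrite invfM mulrA.
rewrite addrC powRD; last by rewrite (gt_eqF n0) implybT.
rewrite ler_wpM2r ?powR_ge0//.
have -> : C1 = (C1 `^ delta^-1) `^ delta.
  by rewrite -powRrM mulVf ?lt0r_neq0// powRr1// ltW.
apply: ge0_ler_powR; rewrite ?nnegrE ?powR_ge0 ?(ltW delta_gt0)//.
by rewrite ltW// (lt_le_trans (truncnS_gt _))// ler_nat.
Qed.
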